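(* If $G$ is a $2$-connected outerplanar graph with $\Delta(G)=\Delta\geq 5$ and girth $g(G)\geq 4$, then $\chi_{vi,1}(G)=\Delta+2$.
   Context: All graphs are finite, simple and undirected. An incidence of $G$ is a pair $(v,e)$ with $v\in V(G)$, $e\in E(G)$, $v\in e$; $I(G)$ is the set of incidences. Let $G^{1/3}$ be obtained from $G$ by replacing each edge $e=\{u,v\}$ by the path $u,(u,e),(v,e),v$. A $vi$-simultaneous proper $k$-coloring of $G$ is a map $c:V(G)\cup I(G)\to\{1,\dots,k\}$ such that any two distinct elements at distance at most $3$ in $G^{1/3}$ receive distinct colors. For a vertex $v$, $I_2(v)=\{(u,\{u,v\}) : u\in N_G(v)\}$. Such a coloring is a $(k,s)$-coloring if for every vertex $v$ at most $s$ distinct colors appear on $I_2(v)$; $\chi_{vi,s}(G)$ is the least such $k$. The girth is the length of a shortest cycle. A graph is outerplanar if it has a planar drawing with all vertices on the outer face. *)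

(* Defs.v *)
From HB Require Import structures.
From mathcomp Require Import all_boot all_order all_algebra.

Set Implicit Arguments.
Unset Strict Implicit.
Unset Printing Implicit Defensive.

Record sgraph := SGraph {
  vertex :> finType;
  adj : rel vertex;
  adj_sym : symmetric adj;
  adj_irrefl : irreflexive adj }.

Section Graph.

Variable G : sgraph.

Definition edges : {set {set G}} :=
  [set [set p.1; p.2] | p in [set p : G * G | adj p.1 p.2]].

Definition neighbours (v : G) : {set G} := [set u | adj v u].

Definition max_degree : nat := \max_(v : G) #|neighbours v|.

Definition connected_off (X : {set G}) : Prop :=
  forall u v : G, u \notin X -> v \notin X ->
    connect [rel a b | [&& adj a b, a \notin X & b \notin X]] u v.

Definition k_connected (k : nat) : Prop :=
  k < #|G| /\ forall X : {set G}, #|X| < k -> connected_off X.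

Definition is_cycle (s : seq G) : bool := (2 < size s) && ucycleb (@adj G) s.

Definition is_girth (g : nat) : Prop :=
  (exists2 s, is_cycle s & size s = g) /\
  (forall s, is_cycle s -> g <= size s).

Definition incidence : Type :=
  {i : G * {set G} | (i.2 \in edges) && (i.1 \in i.2)}.

HB.instance Definition _ := Finite.on incidence.

(* The vertices of G^{1/3}, that is V(G) together with I(G). *)
Definition vi_elt : Type := (G + incidence)%type.

HB.instance Definition _ := Finite.on vi_elt.

(* Each edge e = {u, v} of G becomes the path u, (u, e), (v, e), v. *)
Definition adj_third (x y : vi_elt) : bool :=
  match x, y with
  | inl _, inl _ => false
  | inl u, inr i | inr i, inl u => u == (val i).1
  | inr i, inr j => ((val i).2 == (val j).2) && ((val i).1 != (val j).1)
  end.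

Definition dist_third_le (d : nat) (x y : vi_elt) : Prop :=
  exists p : seq vi_elt,
    [/\ path adj_third x p, last x p = y & size p <= d].

Definition vi_coloring (k : nat) (c : vi_elt -> 'I_k) : Prop :=
  forall x y : vi_elt, x != y -> dist_third_le 3 x y -> c x != c y.

Definition I2 (v : G) : {set incidence} :=
  [set i : incidence |
     ((val i).1 \in neighbours v) && ((val i).2 == [set (val i).1; v])].

Definition vi_ks_coloring (k s : nat) (c : vi_elt -> 'I_k) : Prop :=
  vi_coloring c /\ forall v : G, #|[set c (inr i) | i in I2 v]| <= s.

Definition is_chi_vi (s k : nat) : Prop :=
  (exists c : vi_elt -> 'I_k, vi_ks_coloring s c) /\
  (forall j, (exists c : vi_elt -> 'I_j, vi_ks_coloring s c) -> k <= j).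

End Graph.

From mathcomp Require Import all_classical all_reals all_analysis.
Import Order.TTheory GRing.Theory Num.Theory.
Import numFieldNormedType.Exports.
Local Open Scope classical_set_scope.
Local Open Scope ring_scope.

Section Drawing.

Variables (R : realType) (G : sgraph).

(* [edge_arc e] is only meaningful for e in [edges G] and on [0, 1]. *)
Record drawing := Drawing {
  vertex_point : G -> R * R;
  edge_arc : {set G} -> R -> R * R;
  point_inj : injective vertex_point;
  arc_continuous : forall e, e \in edges G ->
    {within `[0, 1], continuous (edge_arc e)};
  arc_inj : forall e, e \in edges G -> {in `[0, 1] &, injective (edge_arc e)};
  arc_ends : forall e, e \in edges G ->
    [set edge_arc e 0; edge_arc e 1] = vertex_point @` [set` e];
  arc_avoids_points : forall e v (t : R), e \in edges G -> t \in `]0, 1[ ->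
    edge_arc e t <> vertex_point v;
  arcs_disjoint : forall e f (s t : R), e \in edges G -> f \in edges G -> e != f ->
    s \in `]0, 1[ -> t \in `]0, 1[ -> edge_arc e s <> edge_arc f t }.

Definition drawn_set (D : drawing) : set (R * R) :=
  range (vertex_point D) `|` \bigcup_(e in [set` edges G]) (edge_arc D e @` `[0, 1]).

Definition is_face (D : drawing) (F : set (R * R)) : Prop :=
  exists2 p, (~` drawn_set D) p &
    F = connected_component (~` drawn_set D) p.

Definition is_outer_face (D : drawing) (F : set (R * R)) : Prop :=
  is_face D F /\ ~ bounded_set F.

(* A vertex never belongs to a face, which is a subset of the complement of
   the drawing: lying on the outer face means lying on its boundary. *)
Definition outerplanar : Prop :=
  exists (D : drawing) (F : set (R * R)),
    is_outer_face D F /\ forall v : G, closure F (vertex_point D v).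

End Drawing.

(* Main.v *)
Require Import Defs.
From mathcomp Require Import all_boot all_order all_algebra.
From mathcomp Require Import all_classical all_reals all_analysis.
From mathcomp Require Import ring lra zify.
From Stdlib Require Import Btauto.
Set Implicit Arguments.
Unset Strict Implicit.
Unset Printing Implicit Defensive.
Import Order.TTheory GRing.Theory Num.Theory.
Import numFieldNormedType.Exports.

(** A (k,1)-colouring is a colouring [b] of the square of [G] together with a
    proper colouring [a] of [G] such that [a v] avoids [b] on the closed
    neighbourhood of [v]. A vertex v of maximum degree, the incidences at v and
    one incidence (w, vw) are pairwise close, so Delta + 2 colours are needed.

    For the upper bound, the drawing enters only through the absence of a
    K_{2,3} minor. If p, q are joined through three disjoint connected sets
    M_0, M_1, M_2, then p, q and a point of the outer face, against one vertex
    of each M_j, give nine compact sets realising the edges of K_{3,3}, those of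
    independent edges being disjoint; the closure condition suffices because
    the last short segment from the face to a vertex v may only meet sets
    drawn through v. Replacing these sets by fine polygons contradicts the
    parity of the number of crossings of independent edges.

    Without K_{2,3} minors a longest cycle is Hamiltonian, and as [G] has no
    triangles its chords do not cross. The colouring is built by induction,
    removing the inner vertices (at least two) of a face cut off by a single
    chord xy. When that face lies inside a minimal chord that cuts off more than
    one face, x or y has degree at most 4 < Delta, and this leaves enough freedom
    to give the outermost two removed vertices distinct colours. *)

(* The order of abscissas after an infinitesimal shear, so that no genericity
   assumption on the points is needed. *)
Definition lex (R : realFieldType) (p q : R * R) :=
  ((p.1 < q.1) || (p.1 == q.1) && (p.2 < q.2))%R.

Local Notation "p <l q" := (lex p q) (at level 70).

Section Segments.
Local Open Scope ring_scope.
Variable R : realFieldType.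
Implicit Types (a b c d p q r z : R * R) (s t : R).

Definition cross p q := p.1 * q.2 - p.2 * q.1.

Definition orient a b c := cross (b - a) (c - a).

Definition segment a b t : R * R :=
  ((1 - t) * a.1 + t * b.1, (1 - t) * a.2 + t * b.2).

Definition segments_disjoint a b c d :=
  forall s t, 0 <= s <= 1 -> 0 <= t <= 1 -> segment a b s <> segment c d t.

Lemma lexE p q : (p <l q) = @Order.lt _ (R *l R)%type p q.
Proof. by rewrite ltEprodlexi /lex; case: ltgtP => //= _; rewrite implybF. Qed.

Lemma lexP p q : reflect (p.1 < q.1 \/ p.1 = q.1 /\ p.2 < q.2) (p <l q).
Proof.
apply: (iffP orP) => -[|]; [by left| |by left|].
  by case/andP => /eqP; right.
by case=> -> ->; right; rewrite eqxx.
Qed.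

Lemma lex_trans p q r : p <l q -> q <l r -> p <l r.
Proof. by rewrite !lexE; exact: lt_trans. Qed.

Lemma lex_asym p q : p <l q -> (q <l p) = false.
Proof. by rewrite !lexE; exact: lt_gtF. Qed.

Lemma lex_total p q : p != q -> (q <l p) = ~~ (p <l q).
Proof. by move=> pq; rewrite !lexE -leNgt le_eqVlt eq_sym (negbTE pq). Qed.

Lemma lex_sub_gt0 p q : (0 <l q - p) = (p <l q).
Proof. by apply/lexP/lexP => /=; lra. Qed.

Lemma lex_comb_gt0 s t p q : 0 <= s -> 0 <= t -> 0 < s + t -> 0 <l p -> 0 <l q ->
  0 <l (s * p.1 + t * q.1, s * p.2 + t * q.2).
Proof.
move=> + + + /lexP /= p0 /lexP /= q0; rewrite !le_eqVlt => /predU1P[<-|s0].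
  by rewrite add0r !mul0r !add0r => _ t0; apply/lexP => /=; nra.
move=> /predU1P[<-|t0] _; apply/lexP => /=; first by rewrite !mul0r !addr0; nra.
case: p0 => [p0|[<- p0]]; last case: q0 => [q0|[<- q0]].
- by left; nra.
- by left; nra.
- by right; split; nra.
Qed.

Lemma segment0 a b : segment a b 0 = a.
Proof. by case: a => a1 a2; congr (_, _) => /=; ring. Qed.

Lemma segment1 a b : segment a b 1 = b.
Proof. by case: b => b1 b2; congr (_, _) => /=; ring. Qed.

Lemma segment_rev a b t : segment b a t = segment a b (1 - t).
Proof. by congr (_, _); ring. Qed.

Lemma lex_segment_gt a c d t : a <l c -> a <l d -> 0 <= t <= 1 ->
  a <l segment c d t.
Proof.
rewrite -(lex_sub_gt0 a c) -(lex_sub_gt0 a d) -(lex_sub_gt0 a (segment _ _ _)).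
move=> c0 d0 t01; have -> : segment c d t - a =
  ((1 - t) * (c - a).1 + t * (d - a).1, (1 - t) * (c - a).2 + t * (d - a).2).
  by congr (_, _) => /=; ring.
by apply: lex_comb_gt0 => //; lra.
Qed.

Lemma lex_opp p q : (- p <l - q) = (q <l p).
Proof. by apply/lexP/lexP => /=; lra. Qed.

Lemma lex_segment_lt b c d t : c <l b -> d <l b -> 0 <= t <= 1 ->
  segment c d t <l b.
Proof.
rewrite -3!(lex_opp b) => cb db t01; have -> : - segment c d t = segment (- c) (- d) t.
  by congr (_, _) => /=; ring.
exact: lex_segment_gt.
Qed.

Lemma segment_collinear a b z : a <l z -> z <l b -> orient a b z = 0 ->
  exists2 s, 0 <= s <= 1 & z = segment a b s.
Proof.
case: a b z => [a1 a2] [b1 b2] [z1 z2].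
rewrite /orient /cross /segment /= => /lexP /= az /lexP /= zb collinear.
have [ab|ba] := ltP a1 b1.
  have b0 : b1 - a1 != 0 by lra.
  exists ((z1 - a1) / (b1 - a1)).
    by rewrite divr_ge0 ?ler_pdivrMr //=; lra.
  have -> : z2 = a2 + (z1 - a1) * (b2 - a2) / (b1 - a1).
    by apply: (mulfI b0); rewrite mulrDr mulrCA divff //; lra.
  by congr (_, _); field.
have [-> ->] : z1 = a1 /\ b1 = a1 by lra.
exists ((z2 - a2) / (b2 - a2)).
  by rewrite divr_ge0 ?ler_pdivrMr //=; lra.
by congr (_, _); field; lra.
Qed.

Lemma cross_gt0_trans p q r : 0 <l p -> 0 <l q -> 0 <l r ->
  0 < cross q p -> 0 < cross r q -> 0 < cross r p.
Proof.
move=> p0 q0 r0; set u := cross q p; set v := cross r q => u0 v0.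
have := lex_comb_gt0 (ltW v0) (ltW u0) (addr_gt0 v0 u0) p0 r0.
have -> : (v * p.1 + u * r.1, v * p.2 + u * r.2) =
          (cross r p * q.1, cross r p * q.2).
  by rewrite /u /v /cross; congr (_, _); ring.
move=> /lexP /= wq0; move/lexP: q0 {p0 r0} => /= q0.
have [//|w0|w0] := ltgtP 0 (cross r p); last by rewrite -w0 !mul0r in wq0; lra.
by case: q0 => [q10|[q10 q20]]; [nra|rewrite -q10 in wq0; nra].
Qed.

Lemma ratio_itv01 s t : s != t -> s * t <= 0 -> 0 <= s / (s - t) <= 1.
Proof.
move=> st st0; have [lt_st|lt_ts|/eqP] := ltgtP s t; last by rewrite (negbTE st).
  have -> : s / (s - t) = - s / (t - s) by field; lra.
  by rewrite divr_ge0 ?ler_pdivrMr //=; nra.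
by rewrite divr_ge0 ?ler_pdivrMr //=; nra.
Qed.

Lemma separated_segments_meet a b c d :
  orient a b c * orient a b d < 0 -> orient c d a * orient c d b < 0 ->
  ~ segments_disjoint a b c d.
Proof.
move=> sep_ab sep_cd /(_ (orient c d a / (orient c d a - orient c d b))
  (orient a b c / (orient a b c - orient a b d))).
have ab_neq : orient a b c != orient a b d by apply/eqP => E; nra.
have cd_neq : orient c d a != orient c d b by apply/eqP => E; nra.
case; [by apply: ratio_itv01; lra|by apply: ratio_itv01; lra|].
move: ab_neq cd_neq; rewrite -subr_eq0 -(subr_eq0 (orient c d a)) /orient /cross /segment /=.
by move=> ab0 cd0; congr (_, _); field; apply/andP.
Qed.

Lemma nested_same_side a b c d : a <l c -> c <l b -> a <l d -> d <l b ->
  segments_disjoint a b c d -> (0 < orient a b c) = (0 < orient a b d).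
Proof.
move=> ac cb ad db disj; set u := orient a b c; set v := orient a b d.
apply/eqP; apply: contraT => sides.
have uv : u != v by apply: contraNneq sides => ->.
have uv0 : u * v <= 0.
  by move: sides; case: (ltP 0 u) => u0; case: (ltP 0 v) => v0 // _; nra.
have t01 := ratio_itv01 uv uv0.
have : orient a b (segment c d (u / (u - v))) = 0.
  have -> t : orient a b (segment c d t) = u - t * (u - v).
    by rewrite /u /v /orient /cross /=; ring.
  by rewrite divfK ?subrr // subr_eq0.
move/(segment_collinear (lex_segment_gt ac ad t01) (lex_segment_lt cb db t01)) => [s s01 E].
by case: (disj s _ s01 t01).
Qed.

Lemma interleaved_opposite_sides a b c d : a <l c -> c <l b -> b <l d ->
  segments_disjoint a b c d -> (0 < orient a b c) = ~~ (0 < orient c d b).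
Proof.
move=> ac cb bd disj.
have [c0 b0] : orient a b c != 0 /\ orient c d b != 0.
  have I0 : 0 <= (0 : R) <= 1 by lra. have I1 : 0 <= (1 : R) <= 1 by lra.
  split; apply/eqP.
  - by move=> /(segment_collinear ac cb)[s s01 E]; apply: (disj s 0); rewrite ?segment0.
  - by move=> /(segment_collinear cb bd)[s s01 E]; apply: (disj 1 s); rewrite ?segment1.
have [p0 q0 r0] : [/\ 0 <l c - a, 0 <l b - c & 0 <l d - b] by rewrite !lex_sub_gt0.
have Ec : orient a b c = cross (b - c) (c - a) by rewrite /orient /cross /=; ring.
have Eb : orient c d b = cross (d - b) (b - c) by rewrite /orient /cross /=; ring.
have Ed : orient a b d = - (cross (d - b) (c - a) + orient c d b).
  by rewrite /orient /cross /=; ring.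
have Ea : orient c d a = - (cross (d - b) (c - a) + orient a b c).
  by rewrite /orient /cross /=; ring.
have crossN x y : cross x y = - cross y x by rewrite /cross; ring.
have pos_trans : 0 < orient a b c -> 0 < orient c d b -> 0 < cross (d - b) (c - a).
  by rewrite Ec Eb; exact: cross_gt0_trans.
have neg_trans : orient a b c < 0 -> orient c d b < 0 -> cross (d - b) (c - a) < 0.
  rewrite Ec Eb ![cross _ (c - a)]crossN [cross (d - b) _]crossN !oppr_lt0 => *.
  exact: cross_gt0_trans r0 q0 p0 _ _.
have := separated_segments_meet _ _ disj; rewrite Ed Ea.
move: c0 b0 pos_trans neg_trans; set u := orient a b c; set v := orient c d b.
set w := cross _ _; clear.
case: ltrgtP => // u0 _; case: ltrgtP => // v0 _ pos neg meet.
- by have w0 := pos isT isT; exfalso; apply: meet; nra.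
- by have w0 := neg isT isT; exfalso; apply: meet; nra.
Qed.
End Segments.

Lemma addb_xorb : addb =2 xorb. Proof. by case; case. Qed.

Ltac xor := rewrite ?addb_xorb; btauto.

Definition sides (T : Type) (x : T) s := zip (x :: s) s.

Lemma path_sides (T : eqType) (r : rel T) x s e :
  path r x s -> e \in sides x s -> r e.1 e.2.
Proof.
elim: s x => //= y s IH x /andP[xy ys]; rewrite inE => /predU1P[->//|].
exact: IH ys.
Qed.

Section CrossingParity.
Local Open Scope ring_scope.
Variable R : realFieldType.
Implicit Types (a b c d x y : R * R) (s t : seq (R * R)).

Definition above c a b :=
  [&& a <l c, c <l b & 0 < orient a b c] ||
  [&& b <l c, c <l a & 0 < orient b a c].

(* The boundary of the region above [a, b] consists of this segment and of the
   upward rays from a and b; counting modulo 2 how often [c, d] crosses it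
   expresses the crossings of the two segments through their endpoints. *)
Definition crossing a b c d :=
  above c a b (+) above d a b (+) (above a c d (+) above b c d) (+)
  ((c <l a) (+) (d <l a) (+) ((c <l b) (+) (d <l b))).

Lemma above_sym c a b : above c b a = above c a b.
Proof. exact: orbC. Qed.

Lemma above_degenerate c a : above c a a = false.
Proof. by rewrite /above orbb; apply/negbTE/and3P => -[/lex_asym ->]. Qed.

Lemma above_lt c a b : a <l b -> above c a b = [&& a <l c, c <l b & 0 < orient a b c].
Proof.
move=> ab; rewrite /above orbC; have [bc|//] := boolP (b <l c).
by rewrite (lex_asym (lex_trans ab bc)).
Qed.

Lemma crossing_symr a b c d : crossing a b d c = crossing a b c d.
Proof. by rewrite /crossing !(above_sym _ c d); xor. Qed.

Lemma crossing_syml a b c d : crossing b a c d = crossing a b c d.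
Proof. by rewrite /crossing !(above_sym _ a b); xor. Qed.

Lemma segments_disjoint_symr a b c d :
  segments_disjoint a b c d -> segments_disjoint a b d c.
Proof. by move=> h s t s01 t01; rewrite (segment_rev c d); apply: h => //; lra. Qed.

Lemma segments_disjoint_syml a b c d :
  segments_disjoint a b c d -> segments_disjoint b a c d.
Proof. by move=> h s t s01 t01; rewrite (segment_rev a b); apply: h => //; lra. Qed.

Lemma segments_disjoint_sym a b c d :
  segments_disjoint a b c d -> segments_disjoint c d a b.
Proof. by move=> h s t s01 t01 /esym; exact: h. Qed.

Lemma segments_disjoint_neq a b c d :
  segments_disjoint a b c d -> [/\ a != c, a != d, b != c & b != d].
Proof.
have I0 : 0 <= (0 : R) <= 1 by rewrite lexx ler01.
have I1 : 0 <= (1 : R) <= 1 by rewrite lexx ler01.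
move=> h; split; apply/eqP => E.
- by apply: (h 0 0 I0 I0); rewrite !segment0.
- by apply: (h 0 1 I0 I1); rewrite segment0 segment1.
- by apply: (h 1 0 I1 I0); rewrite segment0 segment1.
- by apply: (h 1 1 I1 I1); rewrite !segment1.
Qed.

Lemma crossing_sym a b c d : segments_disjoint a b c d ->
  crossing c d a b = crossing a b c d.
Proof.
move=> /segments_disjoint_neq[ac ad bc bd].
by rewrite /crossing (lex_total ac) (lex_total ad) (lex_total bc) (lex_total bd); xor.
Qed.

Lemma sorted_disjoint_crossing a b c d : a <l b -> c <l d -> a <l c ->
  segments_disjoint a b c d -> crossing a b c d = false.
Proof.
move=> ab cd ac disj; have ad := lex_trans ac cd.
have [_ _ bc bd] := segments_disjoint_neq disj.
rewrite /crossing !above_lt // (lex_asym ac) (lex_asym ad) ac ad /=.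
case: (boolP (c <l b)) => cb; last first.
  rewrite -lex_total 1?eq_sym // in cb.
  by rewrite (lex_asym (lex_trans cb cd)).
case: (boolP (d <l b)) => db.
  by rewrite (nested_same_side ac cb ad db disj) (lex_asym db) addbb.
rewrite -lex_total 1?eq_sym // in db.
by rewrite (interleaved_opposite_sides ac cb db disj) db /=; xor.
Qed.

Lemma disjoint_crossing a b c d :
  segments_disjoint a b c d -> crossing a b c d = false.
Proof.
have [->|nab] := eqVneq a b; first by rewrite /crossing !above_degenerate !addbb.
have [->|ncd] := eqVneq c d; first by rewrite /crossing !above_degenerate !addbb.
wlog ab : a b nab / a <l b => [H disj|].
  have [/H|ba] := boolP (a <l b); first exact.
  rewrite -crossing_syml; apply: H; [by rewrite eq_sym|by rewrite lex_total|].
  exact: segments_disjoint_syml.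
wlog cd : c d ncd / c <l d => [H disj|].
  have [/H|dc] := boolP (c <l d); first exact.
  rewrite -crossing_symr; apply: H; [by rewrite eq_sym|by rewrite lex_total|].
  exact: segments_disjoint_symr.
move=> disj; have [ac _ _ _] := segments_disjoint_neq disj.
have [ac_lt|ca] := boolP (a <l c); first exact: sorted_disjoint_crossing.
rewrite -crossing_sym //; apply: sorted_disjoint_crossing => //.
  by rewrite lex_total.
exact: segments_disjoint_sym.
Qed.

Definition polygons_disjoint x s y t :=
  {in sides x s & sides y t, forall e f, segments_disjoint e.1 e.2 f.1 f.2}.

Definition above_polygon c x s := \big[addb/false]_(e <- sides x s) above c e.1 e.2.

Lemma above_polygon_nil c x : above_polygon c x [::] = false.
Proof. exact: big_nil. Qed.

Lemma above_polygon_cons c x y s :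
  above_polygon c x (y :: s) = above c x y (+) above_polygon c y s.
Proof. exact: big_cons. Qed.

(* The number of crossings modulo 2, see [crossing_parity_cons] and
   [crossing_parity_segment]. *)
Definition crossing_parity x s y t :=
  above_polygon y x s (+) above_polygon (last y t) x s (+)
  (above_polygon x y t (+) above_polygon (last x s) y t) (+)
  ((y <l x) (+) (last y t <l x) (+) ((y <l last x s) (+) (last y t <l last x s))).

Lemma crossing_parity_cons x z s y t :
  crossing_parity x (z :: s) y t = crossing_parity x [:: z] y t (+) crossing_parity z s y t.
Proof. by rewrite /crossing_parity !above_polygon_cons !above_polygon_nil /=; xor. Qed.

Lemma crossing_parity_segment x z y y' t :
  crossing_parity x [:: z] y (y' :: t) = crossing x z y y' (+) crossing_parity x [:: z] y' t.
Proof.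
rewrite /crossing_parity /crossing !above_polygon_cons !above_polygon_nil /=.
by xor.
Qed.

Lemma disjoint_crossing_parity x s y t : polygons_disjoint x s y t ->
  crossing_parity x s y t = false.
Proof.
elim: s x => [|z s IHs] x disj; first by rewrite /crossing_parity !above_polygon_nil !addbb.
rewrite crossing_parity_cons IHs ?addbF => [|e f es]; last first.
  by apply: disj; rewrite inE es orbT.
have: {in sides y t, forall f, segments_disjoint x z f.1 f.2}.
  by move=> f ft; apply: (disj (x, z)); rewrite ?mem_head.
elim: t y {disj IHs} => [|y' t IHt] y xz_disj.
  by rewrite /crossing_parity !above_polygon_nil !addbb.
rewrite crossing_parity_segment (disjoint_crossing (xz_disj (y, y') (mem_head _ _))).
by apply: IHt => f ft; apply: xz_disj; rewrite inE ft orbT.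
Qed.

(* Summed over the 18 pairs of independent edges of K_{3,3}, the terms of
   [crossing_parity] cancel modulo 2 except for an odd constant, which comes
   from the antisymmetry of the lexicographic order. *)
Lemma polygonal_K33_nonplanar (u w : 'I_3 -> R * R) (s : 'I_3 -> 'I_3 -> seq (R * R)) :
  (forall i j, last (u i) (s i j) = w j) -> injective w -> (forall i j, u i != w j) ->
  ~ (forall i k j l : 'I_3, (i < k)%N -> j != l ->
       polygons_disjoint (u i) (s i j) (u k) (s k l)).
Proof.
move=> last_s w_inj uw disj.
have disj_nat i k j l : (i < k < 3)%N && [&& j < 3, l < 3 & j != l]%N ->
    crossing_parity (u (inord i)) (s (inord i) (inord j))
      (u (inord k)) (s (inord k) (inord l)) = false.
  case/andP=> /andP[ik k3] /and3P[j3 l3 jl]; have i3 := ltn_trans ik k3.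
  by apply/disjoint_crossing_parity/disj; rewrite -?val_eqE /= !inordK.
pose pairs n := [seq (i, j) | i <- iota 0 n, j <- iota 0 n].
have lt3 p : p \in pairs 3 -> (p.1 < 3)%N && (p.2 < 3)%N.
  by case/allpairsP=> -[i j] [+ + ->]; rewrite !mem_iota /= => -> ->.
have /= : \big[addb/false]_(ik <- [seq p <- pairs 3 | p.1 < p.2]%N)
    \big[addb/false]_(jl <- [seq p <- pairs 3 | p.1 != p.2])
    crossing_parity (u (inord ik.1)) (s (inord ik.1) (inord jl.1))
      (u (inord ik.2)) (s (inord ik.2) (inord jl.2)) = false.
  rewrite big1_seq // => ik /andP[_]; rewrite mem_filter => /andP[ik_lt /lt3/andP[_ k3]].
  rewrite big1_seq // => jl /andP[_]; rewrite mem_filter => /andP[jl_neq /lt3/andP[j3 l3]].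
  by apply: disj_nat; rewrite ik_lt k3 j3 l3.
have lex_uw i j : (u i <l w j) = ~~ (w j <l u i) by apply: lex_total; rewrite eq_sym.
have lex_ww j l : (j < l < 3)%N -> (w (inord l) <l w (inord j)) = ~~ (w (inord j) <l w (inord l)).
  case/andP=> jl l3; apply: lex_total; rewrite (inj_eq w_inj) -val_eqE /=.
  by rewrite !inordK ?(ltn_trans jl) // ltn_eqF.
rewrite !big_cons !big_nil /crossing_parity !last_s !lex_uw.
rewrite (@lex_ww 0 1) // (@lex_ww 0 2) // (@lex_ww 1 2) //.
move: (inord 0 : 'I_3) (inord 1 : 'I_3) (inord 2 : 'I_3) => o0 o1 o2 sum0.
by suff: true = false by []; apply: etrans sum0; xor.
Qed.
End CrossingParity.

Section ConnectedRelation.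
Local Open Scope classical_set_scope.

Lemma connected_related (T : topologicalType) (A : set T) (r : T -> T -> Prop) :
  connected A -> (forall x y, r x y -> r y x) ->
  (forall x y z, r x y -> r y z -> r x z) ->
  (forall x, A x -> \forall y \near x, A y -> r x y) ->
  forall x y, A x -> A y -> r x y.
Proof.
move=> cA sym trans loc x y Ax Ay.
have rxx z : A z -> r z z by move=> Az; exact: nbhs_singleton (loc z Az) Az.
suff: A `&` r x = A by move=> E; have []: (A `&` r x) y by rewrite E.
apply: cA; first by exists x; split; [|exact: rxx].
- exists [set z | A z -> r x z]°; first exact: open_interior.
  apply/seteqP; split=> z [Az rxz]; split=> //; last exact: (interior_subset rxz).
  by apply: filterS (loc z Az) => t rzt /rzt; exact: trans.
- exists (~` [set z | A z -> ~ r x z]°); first exact/open_closedC/open_interior.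
  apply/seteqP; split=> z [Az rxz]; split=> //.
    by move=> /interior_subset /(_ Az).
  apply: contrapT => nrxz; apply: rxz; apply: filterS (loc z Az) => t rzt /rzt zt xt.
  exact/nrxz/(trans _ _ _ xt)/sym.
Qed.
End ConnectedRelation.

Section Chains.
Local Open Scope classical_set_scope.
Local Open Scope ring_scope.
Variables (R : numFieldType) (T : pseudoMetricType R).
Implicit Types (x y z : T) (K L : set T) (e : R).

Definition close_in K e : rel T := fun x y => `[< [/\ K x, K y & ball x e y] >].

Definition chained K e x y := exists2 s, path (close_in K e) x s & last x s = y.

Definition linked K x y := K x /\ forall e, 0 < e -> chained K e x y.

Lemma chained_trans K e x y z : chained K e x y -> chained K e y z -> chained K e x z.
Proof.
move=> [s xs <-] [t st <-]; exists (s ++ t); last by rewrite last_cat.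
by rewrite cat_path xs.
Qed.

Lemma chained_sym K e x y : chained K e x y -> chained K e y x.
Proof.
move=> [s xs <-]; exists (rev (belast x s)); last first.
  by case: s {xs} => //= z s; rewrite rev_cons last_rcons.
rewrite rev_path; apply: sub_path xs => a b /asboolP[Ka Kb ab].
by apply/asboolP; split=> //; exact: ball_sym.
Qed.

Lemma linked_refl K x : K x -> linked K x x.
Proof. by move=> Kx; split=> // e _; exists [::]. Qed.

Lemma linked_trans K x y z : linked K x y -> linked K y z -> linked K x z.
Proof.
move=> [Kx xy] [_ yz]; split=> // e e0.
exact: chained_trans (xy e e0) (yz e e0).
Qed.

Lemma linked_target K x y : linked K x y -> K y.
Proof.
move=> [Kx /(_ 1 ltr01)[s + <-]]; elim/last_ind: s => //= s z _.
by rewrite rcons_path last_rcons => /andP[_ /asboolP[]].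
Qed.

Lemma linked_sym K x y : linked K x y -> linked K y x.
Proof.
move=> xy; split; first exact: linked_target xy.
by move=> e e0; apply/chained_sym/xy.2.
Qed.

Lemma linked_sub K L x y : K `<=` L -> linked K x y -> linked L x y.
Proof.
move=> KL [Kx xy]; split; [exact: KL|move=> e e0].
have [s xs sy] := xy e e0; exists s => //; apply: sub_path xs => a b /asboolP[Ka Kb ab].
by apply/asboolP; split=> //; exact: KL.
Qed.

Lemma connected_linked K x y : connected K -> K x -> K y -> linked K x y.
Proof.
move=> cK Kx Ky; split=> // e e0; apply: (connected_related cK _ _ _ Kx Ky).
- exact: chained_sym.
- exact: chained_trans.
- move=> a Ka; apply: filterS (nbhsx_ballx a e e0) => b ab Kb.
  by exists [:: b] => //=; rewrite andbT; apply/asboolP.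
Qed.
End Chains.

Section CompactSeparation.
Local Open Scope classical_set_scope.
Local Open Scope ring_scope.

Lemma compact_separated (R : realFieldType) (T : pseudoMetricType R) (K L : set T) :
  compact K -> closed L -> K `&` L = set0 ->
  \forall d \near 0^'+, forall x y, K x -> L y -> ~ ball x (d + d) y.
Proof.
move=> cK cL KL0.
suff: \forall d \near 0^'+, K `<=` [set x | forall y, L y -> ~ ball x (d + d) y].
  by apply: filterS => d sep x y /sep; exact.
apply: (compact_near_coveringP K).1 => // x Kx.
have: nbhs x (~` L).
  apply: open_nbhs_nbhs; split; first exact: closed_openC.
  by move=> Lx; rewrite -[False]/(set0 x) -KL0.
move=> /nbhs_ballP[e /= e0 eL].
exists (ball x (e / 2), [set d | 0 < d < e / 4]).
  split=> /=; first by apply: nbhsx_ballx; rewrite divr_gt0.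
  near=> d; apply/andP; split=> //; near: d; apply: nbhs_right_lt.
  by rewrite divr_gt0.
move=> [z d] /= [xz /andP[d0 de]] y Ly zy; apply: (eL y) => //.
by rewrite (splitr e); apply: (ball_triangle xz); apply: le_ball zy; lra.
Unshelve. all: by end_near. Qed.

End CompactSeparation.

Section TopologicalK33.
Local Open Scope classical_set_scope.
Local Open Scope ring_scope.
Variable R : realType.
Implicit Types (x y z : R * R) (K L : set (R * R)) (d e t : R).

Lemma segment_ball x y e t : ball x e y -> 0 <= t <= 1 -> ball x e (segment x y t).
Proof.
have coord (a b : R) : `|a - b| < e -> 0 <= t <= 1 -> `|a - ((1 - t) * a + t * b)| < e.
  move=> ab /andP[t0 t1]; have -> : a - ((1 - t) * a + t * b) = t * (a - b) by ring.
  by rewrite normrM ger0_norm //; apply: le_lt_trans ab; rewrite ler_piMl.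
by move=> [x1 x2] t01; split; exact: coord.
Qed.

Lemma chains_disjoint K L d x y (s s' : seq (R * R)) :
  (forall x y, K x -> L y -> ~ ball x (d + d) y) ->
  path (close_in K d) x s -> path (close_in L d) y s' -> polygons_disjoint x s y s'.
Proof.
move=> sep xs ys e f /(path_sides xs) /asboolP[Ke _ he] /(path_sides ys) /asboolP[Lf _ hf].
move=> a b a01 b01 E; apply: (sep _ _ Ke Lf); apply: (ball_triangle (segment_ball he a01)).
by rewrite E; apply: ball_sym; exact: segment_ball.
Qed.

Lemma topological_K33_nonplanar (u w : 'I_3 -> R * R) (K : 'I_3 -> 'I_3 -> set (R * R)) :
  (forall i j, compact (K i j)) -> (forall i j, linked (K i j) (u i) (w j)) ->
  ~ (forall i k j l : 'I_3, (i < k)%N -> j != l -> K i j `&` K k l = set0).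
Proof.
move=> cK lK disj.
have notin i k j l x : i != k -> j != l -> K i j x -> K k l x -> False.
  wlog ik : i k j l / (i < k)%N => [H ik jl Kij Kkl|_ jl Kij Kkl].
    have [lt_ik|ki|/val_inj/eqP] := ltngtP i k; last by rewrite (negbTE ik).
      exact: (H i k j l).
    by apply: (H k i l j); rewrite // eq_sym.
  by rewrite -[False]/(set0 x) -(disj i k j l).
have other (i : 'I_3) : exists k, i != k by exists (ordS i); case: i => -[|[|[]]].
have : \forall d \near 0^'+, forall i k j l : 'I_3, (i < k)%N -> j != l ->
    forall x y, K i j x -> K k l y -> ~ ball x (d + d) y.
  do 4!(apply: filter_forall => ?); do 2!(apply: filter_imply => ?).
  apply: compact_separated; [exact: cK| |exact: disj].
  by apply: compact_closed; [exact: norm_hausdorff|exact: cK].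
move=> /(filterI (nbhs_right_gt (0 : R))) /filter_ex[d [d0 sep]].
have /choice[s hs] : forall ij : 'I_3 * 'I_3, exists s,
    path (close_in (K ij.1 ij.2) d) (u ij.1) s /\ last (u ij.1) s = w ij.2.
  by move=> [i j]; have [s] := (lK i j).2 d d0; exists s.
apply: (@polygonal_K33_nonplanar R u w (fun i j => s (i, j))).
- by move=> i j; case: (hs (i, j)).
- move=> j l E; apply/eqP; apply: contraT => jl; have [k ik] := other ord0.
  case: (notin ord0 k j l (w j) ik jl); first exact: linked_target (lK _ _).
  by rewrite E; exact: linked_target (lK _ _).
- move=> i j; apply/eqP => E; have [[k ik] [l jl]] := (other i, other j).
  case: (notin i k l j (u i) ik); rewrite 1?eq_sym //; first by case: (lK i l).
  by rewrite E; exact: linked_target (lK _ _).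
- move=> i k j l ik jl; have [pij _] := hs (i, j); have [pkl _] := hs (k, l).
  exact: chains_disjoint (sep _ _ _ _ ik jl) pij pkl.
Qed.

Lemma continuous_segment x y : continuous (segment x y).
Proof.
move=> t; have lin (a b : R) : (1 - s) * a + s * b @[s --> t] --> (1 - t) * a + t * b.
  apply: cvgD; apply: cvgMr_tmp; last exact: cvg_id.
  by apply: cvgB; [exact: cvg_cst|exact: cvg_id].
by have h := cvg_pair (lin x.1 y.1) (lin x.2 y.2) => A hA; exact: h.
Qed.

Lemma segment_image_compact x y : compact (segment x y @` `[0, 1]).
Proof.
apply: continuous_compact; last exact: segment_compact.
exact/continuous_subspaceT/continuous_segment.
Qed.

Lemma segment_image_linked x y : linked (segment x y @` `[0, 1]) x y.
Proof.
apply: connected_linked.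
- apply: connected_continuous_connected; first exact: segment_connected.
  exact/continuous_subspaceT/continuous_segment.
- by exists 0; rewrite ?segment0 //= in_itv /= lexx ler01.
- by exists 1; rewrite ?segment1 //= in_itv /= lexx ler01.
Qed.

Lemma segment_image_ball x y e : ball x e y -> segment x y @` `[0, 1] `<=` ball x e.
Proof. by move=> xy _ [t + <-]; rewrite /= in_itv /=; exact: segment_ball. Qed.

Definition compactly_linked (U : set (R * R)) x y :=
  exists K, [/\ compact K, K `<=` U & linked K x y].

Lemma compactly_linked_sym U x y : compactly_linked U x y -> compactly_linked U y x.
Proof. by move=> [K [cK KU xy]]; exists K; split=> //; exact: linked_sym. Qed.

Lemma compactly_linked_trans U x y z :
  compactly_linked U x y -> compactly_linked U y z -> compactly_linked U x z.
Proof.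
move=> [K [cK KU xy]] [L [cL LU yz]]; exists (K `|` L); split.
- exact: compactU.
- by rewrite subUset.
- exact: linked_trans (linked_sub (@subsetUl _ K L) xy) (linked_sub (@subsetUr _ K L) yz).
Qed.

Lemma compactly_linked_ball U x y e :
  ball x e `<=` U -> ball x e y -> compactly_linked U x y.
Proof.
move=> xU xy; exists (segment x y @` `[0, 1]); split.
- exact: segment_image_compact.
- exact: subset_trans (segment_image_ball xy) xU.
- exact: segment_image_linked.
Qed.

Lemma open_connected_compactly_linked (U F : set (R * R)) x y : open U -> connected F ->
  F `<=` U -> F x -> F y -> compactly_linked U x y.
Proof.
move=> oU cF FU; apply: connected_related => //.
- exact: compactly_linked_sym.
- exact: compactly_linked_trans.
- move=> a /FU Ua; have /nbhs_ballP[e /= e0 eU] : nbhs a U by apply: open_nbhs_nbhs.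
  apply: filterS (nbhsx_ballx a e e0) => b ab _.
  exact: compactly_linked_ball eU ab.
Qed.
End TopologicalK33.

Section ConnectedSets.
Variable G : sgraph.
Implicit Types (u v w p q x : G) (s : seq G) (S T : {set G}).

Lemma adj_neq (u v : G) : adj u v -> u != v.
Proof. by apply: contraTneq => ->; rewrite adj_irrefl. Qed.

Definition induced_adj S : rel G := fun a b => [&& adj a b, a \in S & b \in S].

Definition connected_in S := {in S &, forall u v, connect (induced_adj S) u v}.

Lemma connected_in_star S x :
  (forall v, v \in S -> connect (induced_adj S) x v) -> connected_in S.
Proof.
have sym : connect_sym (induced_adj S).
  by apply: sym_connect_sym => a b; rewrite /induced_adj adj_sym; congr andb; rewrite andbC.
by move=> xS u v uS vS; apply: connect_trans (xS v vS); rewrite sym; exact: xS.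
Qed.

Lemma path_induced_adj S x s :
  {subset x :: s <= S} -> path (@adj G) x s -> path (induced_adj S) x s.
Proof.
move=> sub xs; apply: (sub_in_path (P := mem S)) xs; last exact/allP.
by move=> a b aS bS ab; apply/and3P.
Qed.

Lemma connected_in_path x s : path (@adj G) x s -> connected_in [set v in x :: s].
Proof.
move=> xs; apply: (@connected_in_star _ x) => v; rewrite inE.
by apply: path_connect; apply: path_induced_adj xs => z zs; rewrite inE.
Qed.

Definition links p q S := [/\ connected_in S, p \notin S, q \notin S,
  exists2 w, w \in S & adj p w & exists2 w, w \in S & adj q w].

Lemma links_disjoint_stars p q S T : p != q -> links p q S -> links p q T ->
  [disjoint S & T] -> [disjoint p |: S & q |: T].
Proof.
move=> pq [_ _ qS _ _] [_ pT _ _ _] ST.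
rewrite disjoint_subset; apply/fintype.subsetP => x; rewrite !inE => /predU1P[->|xS].
  by rewrite negb_or pq.
by rewrite negb_or (disjointFr ST) // andbT; apply: contraNneq qS => <-.
Qed.

Lemma linksC p q S : links p q S -> links q p S.
Proof. by case. Qed.

Definition K23_minor_free := forall p q (M : 'I_3 -> {set G}), p != q ->
  (forall j, links p q (M j)) ->
  ~ (forall j l : 'I_3, j < l -> [disjoint M j & M l]).

End ConnectedSets.

Section DrawnSubgraphs.
Local Open Scope classical_set_scope.
Local Open Scope ring_scope.
Variables (R : realType) (G : sgraph) (D : drawing R G).
Implicit Types (u v w p q : G) (S T : {set G}) (e f : {set G}) (F L : set (R * R)) (t : R).

Let point := vertex_point D.

Definition arc_image e := edge_arc D e @` `[0, 1].

Definition drawn S : set (R * R) :=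
  point @` [set` S] `|` \bigcup_(e in [set e | (e \in edges G) && (e \subset S)]) arc_image e.

Lemma arc_image_compact e : e \in edges G -> compact (arc_image e).
Proof.
move=> eG; apply: continuous_compact; last exact: segment_compact.
exact: arc_continuous.
Qed.

Lemma drawn_compact S : compact (drawn S).
Proof.
apply: compactU; first exact/finite_compact/finite_image/finite_finset.
rewrite (@bigcup_pred _ _ [pred e | (e \in edges G) && (e \subset S)]).
by apply: bigsetU_compact => e /andP[eG _]; exact: arc_image_compact.
Qed.

Lemma drawn_closed S : closed (drawn S).
Proof. by apply: compact_closed; [exact: norm_hausdorff|exact: drawn_compact]. Qed.

Lemma drawnT : drawn [set: G]%SET = drawn_set D.
Proof.
rewrite /drawn /drawn_set; congr (_ `|` _).
  by congr image; apply/seteqP; split=> v //= _; rewrite inE.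
by apply: eq_bigcupl; split=> e /=; rewrite finset.subsetT andbT.
Qed.

Lemma sub_drawn S T : S \subset T -> drawn S `<=` drawn T.
Proof.
move=> ST; apply: setUSS => [z [v vS <-]|z [e /andP[eG eS] ez]].
  by exists v => //; exact: (fintype.subsetP ST).
by exists e => //=; rewrite eG (fintype.subset_trans eS).
Qed.

Lemma drawn_point S v : v \in S -> drawn S (point v).
Proof. by move=> vS; left; exists v. Qed.

Lemma arc_image_cases e z : e \in edges G -> arc_image e z ->
  (exists2 v, v \in e & z = point v) \/ (exists2 t, t \in `]0, 1[%R & z = edge_arc D e t).
Proof.
move=> eG [t /=]; rewrite in_itv /= => t01 <-.
have [ends0 ends1] : [set edge_arc D e 0; edge_arc D e 1] (edge_arc D e 0) /\
    [set edge_arc D e 0; edge_arc D e 1] (edge_arc D e 1) by split; [left|right].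
have [->|t0] := eqVneq t 0.
  by left; move: ends0; rewrite arc_ends // => -[v ve <-]; exists v.
have [->|t1] := eqVneq t 1.
  by left; move: ends1; rewrite arc_ends // => -[v ve <-]; exists v.
by right; exists t => //; rewrite in_itv /= !lt_neqAle t1 eq_sym t0.
Qed.

Lemma drawn_cases S z : drawn S z -> (exists2 v, v \in S & z = point v) \/
  exists2 e, (e \in edges G) && (e \subset S) & exists2 t, t \in `]0, 1[%R & z = edge_arc D e t.
Proof.
case=> [[v vS <-]|[e /andP[eG eS] /(arc_image_cases eG)[[v ve ->]|ez]]].
- by left; exists v.
- by left; exists v => //; exact: (fintype.subsetP eS).
- by right; exists e; rewrite ?eG.
Qed.

Lemma edge_nonempty e : e \in edges G -> exists v, v \in e.
Proof. by case/imsetP => -[u v] _ ->; exists u; rewrite !inE eqxx. Qed.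

Lemma drawn_disjoint S T : [disjoint S & T]%B -> drawn S `&` drawn T = set0.
Proof.
move=> ST; apply/seteqP; split=> // z [/drawn_cases zS /drawn_cases zT].
case: zS zT => [[v vS ->]|[e /andP[eG eS] [s s01 ->]]].
  case=> [[w wT /point_inj vw]|[f /andP[fG _] [t t01 /esym]]].
    by rewrite -vw (disjointFr ST vS) in wT.
  exact: arc_avoids_points.
case=> [[w wT]|[f /andP[fG fT] [t t01]]]; first exact: arc_avoids_points.
apply: arcs_disjoint => //; apply: contraTneq eS => ->; have [v vf] := edge_nonempty fG.
by apply/subsetPn; exists v; rewrite // (disjointFl ST) // (fintype.subsetP fT).
Qed.

Lemma adj_edge u v : adj u v -> [set u; v]%SET \in edges G.
Proof. by move=> uv; apply/imsetP; exists (u, v); rewrite ?inE. Qed.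

Lemma arc_image_linked e u v : e \in edges G -> u \in e -> v \in e ->
  linked (arc_image e) (point u) (point v).
Proof.
move=> eG ue ve; have ends w : w \in e -> arc_image e (point w).
  move=> we; have : (point @` [set` e]) (point w) by exists w.
  rewrite -(arc_ends D eG) => -[] ->; [exists 0|exists 1] => //=;
  by rewrite in_itv /= ?lexx ler01.
apply: connected_linked; [|exact: ends|exact: ends].
apply: connected_continuous_connected; first exact: segment_connected.
exact: arc_continuous.
Qed.

Lemma drawn_adj_linked S u v : adj u v -> u \in S -> v \in S ->
  linked (drawn S) (point u) (point v).
Proof.
move=> uv uS vS; apply: (@linked_sub _ _ (arc_image [set u; v]%SET)).
  move=> z uvz; right; exists [set u; v]%SET => //=.
  by rewrite adj_edge // finset.subUset !finset.sub1set uS.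
by apply: arc_image_linked; rewrite ?adj_edge // !inE eqxx ?orbT.
Qed.

Lemma drawn_connected_linked S u v : connected_in S -> u \in S -> v \in S ->
  linked (drawn S) (point u) (point v).
Proof.
move=> cS uS vS; have /connectP[s us ->] := cS u v uS vS.
elim: s u uS us {v vS} => [|w s IH] u uS /=.
  by move=> _; apply: linked_refl; exact: drawn_point.
by case/andP => /and3P[uw _ wS] /(IH _ wS); apply: linked_trans; exact: drawn_adj_linked.
Qed.

Lemma drawn_star_linked S p v : connected_in S -> (exists2 w, w \in S & adj p w) ->
  v \in S -> linked (drawn (p |: S)%SET) (point p) (point v).
Proof.
move=> cS [w wS pw] vS; apply: (@linked_trans _ _ _ _ (point w)).
  by apply: drawn_adj_linked; rewrite // !inE ?eqxx ?wS ?orbT.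
apply: (@linked_sub _ _ (drawn S)); first exact/sub_drawn/subsetU1.
exact: drawn_connected_linked.
Qed.

Lemma face_vertex_linked F z v : is_face D F -> F z -> closure F (point v) ->
  exists L, [/\ compact L, linked L z (point v) &
    forall T, v \notin T -> L `&` drawn T = set0].
Proof.
move=> [p _ FE] Fz Fv; set U := ~` drawn_set D in FE.
have oU : open U by apply: closed_openC; rewrite -drawnT; exact: drawn_closed.
have FU : F `<=` U by rewrite FE; exact: connected_component_sub.
have cF : connected F by rewrite FE; exact: component_connected.
pose W := drawn (~: [set v])%SET.
have /nbhs_ballP[r /= r0 rW] : nbhs (point v) (~` W).
  apply: open_nbhs_nbhs; split; first exact/closed_openC/drawn_closed.
  have v_Cv : [disjoint [set v]%SET & (~: [set v])%SET]%B by rewrite disjoints1 !inE eqxx.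
  move=> Wv; rewrite -[False]/(set0 (point v)) -(drawn_disjoint v_Cv); split=> //.
  by apply: drawn_point; rewrite inE.
have [y [Fy vy]] := Fv _ (nbhsx_ballx _ _ r0).
have [K [cK KU zy]] := open_connected_compactly_linked oU cF FU Fz Fy.
pose I := segment (point v) y @` `[0, 1].
exists (K `|` I); split.
- by apply: compactU => //; exact: segment_image_compact.
- apply: linked_trans (linked_sub (@subsetUl _ K I) zy) _.
  exact/linked_sym/(linked_sub (@subsetUr _ K I))/segment_image_linked.
move=> T vT; apply/seteqP; split=> // x [Lx Tx].
have Wx : W x.
  apply: sub_drawn Tx; apply/fintype.subsetP => w wT; rewrite !inE.
  by apply: contraNneq vT => <-.
case: Lx => [/KU|/(segment_image_ball vy)/rW//].
by apply; rewrite -drawnT; apply: sub_drawn Wx; exact: finset.subsetT.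
Qed.

Lemma outer_face_K23_minor_free F : is_face D F -> (forall v, closure F (point v)) ->
  K23_minor_free G.
Proof.
move=> fF cF p q M pq links_M dis_M.
have [z [Fz _]] := cF p _ (nbhsx_ballx _ _ ltr01).
have /choice[m mM] j : exists v, v \in M j by have [_ _ _ [w wM _] _] := links_M j; exists w.
have /choice[L L_spec] j := face_vertex_linked fF Fz (cF (m j)).
have {}dis_M j l : j != l -> [disjoint M j & M l]%B.
  have [lt_jl|lt_lj|/val_inj ->] := ltngtP j l; last by rewrite eqxx.
    by move=> _; exact: dis_M.
  by rewrite disjoint_sym => _; exact: dis_M.
have m_notin j l x : j != l -> m l != x -> m l \notin (x |: M j)%SET.
  by rewrite !inE negb_or => /dis_M jl ->; rewrite (disjointFl jl).
have m_neq j x : x \notin M j -> m j != x by apply: contraNneq => <-.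
pose K i j := nth (L j) [:: drawn (p |: M j)%SET; drawn (q |: M j)%SET] i.
apply: (@topological_K33_nonplanar R (nth z [:: point p; point q]) (point \o m) K).
- by move=> [[|[|[|//]]] i3] j; rewrite /K /=; [exact: drawn_compact..|case: (L_spec j)].
- move=> [[|[|[|//]]] i3] j; rewrite /K /=; last by case: (L_spec j).
    by have [cM _ _ pM _] := links_M j; exact: drawn_star_linked.
  by have [cM _ _ _ qM] := links_M j; exact: drawn_star_linked.
- have disL j l : j != l -> L l `&` drawn (p |: M j)%SET = set0 /\
      L l `&` drawn (q |: M j)%SET = set0.
    move=> jl; have [_ pl ql _ _] := links_M l; have [_ _ avoids] := L_spec l.
    by split; apply: avoids; apply: m_notin; rewrite // m_neq.
  move=> [[|[|[|//]]] i3] [[|[|[|//]]] k3] j l //= _ jl; rewrite /K /=.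
  + by apply/drawn_disjoint/links_disjoint_stars => //; exact: dis_M.
  + by rewrite setIC; case: (disL j l jl).
  + by rewrite setIC; case: (disL j l jl).
Qed.
End DrawnSubgraphs.

Section Hamiltonian.
Variable G : sgraph.
Implicit Types (u v w p q : G) (s t : seq G) (A K : {set G}).

Definition triangle_free := forall u v w, adj u v -> adj v w -> adj u w -> False.

Lemma links_path p q s : s != [::] -> path (@adj G) p (rcons s q) ->
  p \notin s -> q \notin s -> links p q [set v in s].
Proof.
case: s => [//|x s] _; rewrite rcons_path /= => /andP[/andP[px xs] sq] ps qs.
split; rewrite ?inE //; first exact: connected_in_path.
  by exists x; rewrite ?inE ?eqxx.
by exists (last x s); rewrite 1?adj_sym // inE mem_last.
Qed.

Lemma cycle_no_outer_link p q s1 s2 K : K23_minor_free G ->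
  cycle (@adj G) (p :: s1 ++ q :: s2) -> uniq (p :: s1 ++ q :: s2) ->
  s1 != [::] -> s2 != [::] -> links p q K ->
  {in K, forall v, v \notin p :: s1 ++ q :: s2} -> False.
Proof.
move=> free; rewrite /= -cat_rcons rcons_cat cat_path last_rcons => /andP[pq qp].
rewrite cat_rcons mem_cat inE !negb_or cat_uniq /= negb_or.
move=> /andP[/and3P[p1 p_neq_q p2] /and3P[_ /andP[q1 d12] /andP[q2 _]]] s1n s2n pqK dK.
pose M j := nth K [:: [set v in s1]; [set v in s2]] j.
apply: (free p q M p_neq_q) => [[[|[|[|//]]] j3]|].
- exact: links_path.
- exact/linksC/links_path.
- exact: pqK.
have dis (s t : seq G) (A : {set G}) : {in A, forall v, v \notin t} -> {subset s <= t} ->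
    [disjoint [set v in s] & A].
  move=> At st; rewrite disjoint_subset; apply/fintype.subsetP => v; rewrite !inE => /st.
  by apply: contraL => /At.
have d1K : [disjoint [set v in s1] & K].
  by apply: dis dK _ => v v1; rewrite !(inE, mem_cat) v1 orbT.
have d2K : [disjoint [set v in s2] & K].
  by apply: dis dK _ => v v2; rewrite !(inE, mem_cat) v2 !orbT.
have d12_set : [disjoint [set v in s1] & [set v in s2]].
  apply: (dis _ s1) => // v; rewrite inE => v2.
  by apply: contra d12 => v1; apply/hasP; exists v.
by case=> [[|[|[|//]]] j3] [[|[|[|//]]] l3].
Qed.

Lemma cycle_no_crossing_chords p q x y s1 s2 s3 s4 : K23_minor_free G ->
  cycle (@adj G) (p :: s1 ++ q :: s2 ++ x :: s3 ++ y :: s4) ->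
  uniq (p :: s1 ++ q :: s2 ++ x :: s3 ++ y :: s4) ->
  adj p x -> adj q y -> s1 != [::] -> False.
Proof.
have -> : p :: s1 ++ q :: s2 ++ x :: s3 ++ y :: s4 =
    (p :: s1 ++ q :: rcons s2 x) ++ (s3 ++ y :: s4).
  by rewrite /= -catA /= cat_rcons.
set s5 := s3 ++ y :: s4 => free cy; rewrite cat_uniq => /and3P[u_pqx d5 _] px qy s1n.
have y5 : y \in s5 by rewrite mem_cat mem_head orbT.
have [z [s5' E5]] : exists z s, s5 = z :: s by case: (s5) y5 => // z s; exists z, s.
move: cy; rewrite /= rcons_cat cat_path => /andP[pqx /=].
rewrite E5 rcons_path /= => /andP[/andP[xz zs] lp].
apply: (@cycle_no_outer_link p q s1 (rcons s2 x) [set v in s5]) => //.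
- by rewrite /= rcons_path pqx last_cat /= last_rcons adj_sym px.
- by case: (s2).
- have [p5 q5] : p \notin s5 /\ q \notin s5.
    by split; apply: (contra _ d5) => v5; apply/hasP; [exists p|exists q];
      rewrite // !(inE, mem_cat) eqxx ?orbT.
  split; rewrite ?inE //.
  + by rewrite E5; exact: connected_in_path.
  + by exists (last z s5'); rewrite 1?adj_sym // inE E5 mem_last.
  + by exists y; rewrite ?inE.
- by move=> v; rewrite inE => v5; apply: contra d5 => vs; apply/hasP; exists v.
Qed.

Lemma triangle_free_no_crossing_chords p q x y s1 s2 s3 s4 :
  K23_minor_free G -> triangle_free ->
  cycle (@adj G) (p :: s1 ++ q :: s2 ++ x :: s3 ++ y :: s4) ->
  uniq (p :: s1 ++ q :: s2 ++ x :: s3 ++ y :: s4) ->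
  adj p x -> adj q y -> False.
Proof.
move=> free tf cy un px qy.
have [s10|] := eqVneq s1 [::]; last exact: (cycle_no_crossing_chords free cy un px qy).
have [s20|s2n] := eqVneq s2 [::].
  by move: cy; rewrite s10 s20 /= => /and3P[pq qx _]; exact: (tf p q x).
have E : rot (size (p :: s1)) (p :: s1 ++ q :: s2 ++ x :: s3 ++ y :: s4) =
    q :: s2 ++ x :: s3 ++ y :: s4 ++ p :: s1.
  by rewrite -cat_cons rot_size_cat /= -!catA /= -!catA.
apply: (@cycle_no_crossing_chords q x y p s2 s3 s4 s1 free) => //.
- by rewrite -E rot_cycle.
- by rewrite -E rot_uniq.
- by rewrite adj_sym.
Qed.

Lemma link_lengthens_cycle p q s K : cycle (@adj G) (p :: q :: s) -> uniq (p :: q :: s) ->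
  links p q K -> {in K, forall v, v \notin p :: q :: s} ->
  exists2 s' : seq G, is_cycle s' & size (p :: q :: s) < size s'.
Proof.
move=> cy un [cK _ _ [wp wpK pwp] [wq wqK qwq]] dK.
have /connectP[t0 wt0] := cK wp wq wpK wqK.
case: (shortenP wt0) => t wt ut _ lt {t0 wt0}.
have tK : {subset wp :: t <= K}.
  apply/allP; rewrite /= wpK; apply/(all_nthP wp) => i it.
  by have /(pathP wp) /(_ i it) /and3P[] := wt.
have wta : path (@adj G) wp t by apply: sub_path wt => a b /and3P[].
exists (p :: (wp :: t) ++ q :: s); last by rewrite /= size_cat /= !ltnS addnS ltnS leq_addl.
rewrite /is_cycle /ucycleb; apply/and3P; split.
- by rewrite /= size_cat /= addnS.
- move: cy => /= /andP[_ qs].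
  by rewrite rcons_cat cat_path pwp wta /= -lt adj_sym qwq.
have: perm_eq ((wp :: t) ++ p :: q :: s) (p :: (wp :: t) ++ q :: s).
  by rewrite -(cat1s p (q :: s)) -(cat1s p (_ ++ _)) perm_catCA.
move/perm_uniq <-; rewrite cat_uniq ut un andbT; apply/hasPn => v vs.
by apply: contraL vs => /tK /dK.
Qed.

Definition component A v := [set w | connect (induced_adj A) v w].

Definition attachments A v := [set p in ~: A | [exists w in component A v, adj p w]].

Lemma mem_component A v : v \in component A v.
Proof. by rewrite inE connect0. Qed.

Lemma sub_component A v : v \in A -> component A v \subset A.
Proof.
move=> vA; apply/fintype.subsetP => w; rewrite inE => /connectP[t + ->].
by elim/last_ind: t => //= t y _; rewrite rcons_path last_rcons => /andP[_ /and3P[]].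
Qed.

Lemma component_step A v w z : v \in A -> w \in component A v -> adj w z -> z \in A ->
  z \in component A v.
Proof.
move=> vA wC wz zA; have wA := fintype.subsetP (sub_component vA) w wC.
move: wC; rewrite !inE => vw; apply: connect_trans vw (connect1 _).
exact/and3P.
Qed.

Lemma connected_in_component A v : connected_in (component A v).
Proof.
apply: (@connected_in_star _ _ v) => w; rewrite inE => /connectP[t vt ->].
apply/connectP; exists t => //; apply: path_induced_adj.
  by move=> z zt; rewrite inE; exact: path_connect zt.
by apply: sub_path vt => a b /and3P[].
Qed.

Lemma attachments_card k A v : k_connected G k -> v \in A -> k <= #|~: A| ->
  k <= #|attachments A v|.
Proof.
move=> [_ conn] vA kA; rewrite leqNgt; apply/negP => att_k.
have /fintype.subsetPn[z zA z_att] : ~~ (~: A \subset attachments A v).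
  by apply: contraL att_k => /subset_leq_card; rewrite -leqNgt; exact: leq_trans.
have v_att : v \notin attachments A v by rewrite !inE vA.
suff: z \in component A v.
  by move/(fintype.subsetP (sub_component vA)); move: zA; rewrite inE => /negP.
have /connectP[t vt ->] := conn _ att_k v z v_att z_att.
elim/last_ind: t vt => [_|t y IH]; first exact: mem_component.
rewrite rcons_path last_rcons => /andP[/IH xC /and3P[xy _ y_att]].
apply: (component_step vA xC xy); apply: contraNT y_att => yA.
by rewrite !inE yA; apply/existsP; exists (last v t); rewrite xC adj_sym.
Qed.

Definition longest_cycle s := is_cycle s /\ forall s' : seq G, is_cycle s' -> size s' <= size s.

Lemma exists_longest_cycle s : is_cycle s -> exists s', longest_cycle s'.
Proof.
move=> cs; pose is_length n := `[< exists2 s : seq G, is_cycle s & size s = n >].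
have ex : exists n, is_length n by exists (size s); apply/asboolP; exists s.
have bound n : is_length n -> n <= #|G|.
  by move/asboolP => [t /and3P[_ _ ut] <-]; rewrite -(card_uniqP ut) max_card.
have [n /asboolP[t ct <-] tmax] := ex_maxnP ex bound.
by exists t; split=> // s' cs'; apply: tmax; apply/asboolP; exists s'.
Qed.

Lemma longest_cycle_hamiltonian s : k_connected G 2 -> K23_minor_free G ->
  longest_cycle s -> forall v, v \in s.
Proof.
move=> conn free [/and3P[s3 cs us] smax] v; apply: contraT => vs.
pose A := [set w | w \notin s]; have vA : v \in A by rewrite inE.
have CA : ~: A =i s by move=> w; rewrite !inE negbK.
have /card_gt1P[p [q []]] : 1 < #|attachments A v|.
  apply: attachments_card => //; rewrite (eq_card CA) (card_uniqP us); exact: ltnW.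
rewrite !inE !negbK => /andP[ps /exists_inP[wp wpC pwp]] /andP[qs /exists_inP[wq wqC qwq]] pq.
set C := component A v in wpC wqC.
have Cs w : w \in C -> w \notin s.
  by move/(fintype.subsetP (sub_component vA)); rewrite inE.
have pqC : links p q C.
  split; [exact: connected_in_component| | |by exists wp|by exists wq].
    by apply: contraL ps => /Cs.
  by apply: contraL qs => /Cs.
case: (rot_to_arc us ps qs pq) => i s1 s2 _ _ E.
have cE : cycle (@adj G) (p :: s1 ++ q :: s2) by rewrite -E rot_cycle.
have uE : uniq (p :: s1 ++ q :: s2) by rewrite -E rot_uniq.
have {}Cs : {in C, forall w, w \notin p :: s1 ++ q :: s2}.
  by move=> w /Cs; rewrite -E mem_rot.
have sE : size s = size (p :: s1 ++ q :: s2) by rewrite -E size_rot.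
have [s10|s1n] := eqVneq s1 [::].
  subst s1; have [s' /smax] := link_lengthens_cycle cE uE pqC Cs.
  by rewrite sE leqNgt => /negP.
have [s20|s2n] := eqVneq s2 [::]; last by case: (cycle_no_outer_link free cE uE s1n s2n pqC).
have Eq : rot (size (p :: s1)) (p :: s1 ++ q :: s2) = q :: p :: s1.
  by rewrite s20 -cat_cons rot_size_cat.
have [||w /Cs|s' /smax] := @link_lengthens_cycle q p s1 C _ _ (linksC pqC).
- by rewrite -Eq rot_cycle.
- by rewrite -Eq rot_uniq.
- by rewrite -Eq mem_rot.
- by rewrite -Eq size_rot sE leqNgt => /negP.
Qed.
End Hamiltonian.

Section PairColouring.
Variable k : nat.
Implicit Types (f : nat -> 'I_k).

(* A (k,1)-colouring amounts to such a pair for the adjacency relation: [a]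
   colours the vertices and [b v] is the only colour used on I_2(v). *)
Definition pair_colouring (V : eqType) (e : rel V) (S : {pred V}) (a b : V -> 'I_k) :=
  [/\ {in S &, forall u v, e u v -> [/\ a u != a v, b u != b v & a u != b v]},
      {in S, forall u, a u != b u} &
      {in S & &, forall u v w, u != w -> e u v -> e v w -> b u != b w}].

Lemma eq_in_pair_colouring (V : eqType) (e : rel V) (S : {pred V}) (a b a' b' : V -> 'I_k) :
  {in S, a =1 a'} -> {in S, b =1 b'} -> pair_colouring e S a b -> pair_colouring e S a' b'.
Proof.
move=> aa bb [edge own dist2]; split.
- by move=> u v uS vS; rewrite -!aa // -!bb //; exact: edge.
- by move=> u uS; rewrite -aa // -bb //; exact: own.
- by move=> u v w uS vS wS; rewrite -!bb //; exact: dist2.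
Qed.

Lemma pair_colouring_pullback (V W : eqType) (e : rel V) (e' : rel W) (S : {pred V})
    (T : {pred W}) (f : V -> W) (a b : W -> 'I_k) :
  {in S, forall u, f u \in T} -> {in S &, injective f} ->
  {in S &, forall u v, e u v -> e' (f u) (f v)} ->
  pair_colouring e' T a b -> pair_colouring e S (a \o f) (b \o f).
Proof.
move=> fT f_inj fe [edge own dist2]; split=> /=.
- by move=> u v uS vS uv; apply: edge; rewrite ?fT ?fe.
- by move=> u uS; apply: own; exact: fT.
- move=> u v w uS vS wS uw uv vw; apply: (dist2 _ (f v)); rewrite ?fT ?fe //.
  by rewrite (inj_in_eq f_inj).
Qed.

Lemma pair_colouring_glue (V : finType) (e : rel V) (S T : {set V}) (a b : V -> 'I_k) :
  symmetric e -> pair_colouring e S a b -> pair_colouring e T a b ->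
  {in S :\: T & T :\: S, forall u v, ~~ e u v} ->
  (forall u v w, u \in S :\: T -> v \in S :&: T -> w \in T :\: S -> e u v -> e v w ->
    b u != b w) ->
  pair_colouring e (S :|: T) a b.
Proof.
move=> esym [edgeS ownS dist2S] [edgeT ownT dist2T] sep mid.
have both u v : u \in S :|: T -> v \in S :|: T -> e u v ->
    (u \in S) && (v \in S) || (u \in T) && (v \in T).
  move=> uST vST uv; apply: contraT => split_uv.
  have: (u \in S :\: T) && (v \in T :\: S) || (v \in S :\: T) && (u \in T :\: S).
    by move: uST vST split_uv; rewrite !inE; do 4![case: (_ \in _)].
  by case/orP=> /andP[uD vD]; have := sep _ _ uD vD; rewrite ?uv // esym uv.
have mixed u v w : u \in S -> v \in S -> v \in T -> w \in T -> u != w -> e u v -> e v w ->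
    b u != b w.
  move=> uS vS vT wT uw uv vw; have [uT|uT] := boolP (u \in T); first exact: (dist2T u v w).
  have [wS|wS] := boolP (w \in S); first exact: (dist2S u v w).
  by apply: (mid u v w); rewrite // inE ?uT ?vS ?wS.
split.
- by move=> u v uST vST uv; case/orP: (both u v uST vST uv) => /andP[u_in v_in];
    [exact: edgeS|exact: edgeT].
- by move=> u; rewrite inE => /orP[]; [exact: ownS|exact: ownT].
- move=> u v w uST vST wST uw uv vw.
  case/orP: (both u v uST vST uv) => /andP[u_in v_in];
    case/orP: (both v w vST wST vw) => /andP[v_in' w_in].
  + exact: (dist2S u v w).
  + exact: (mixed u v w).
  + by rewrite eq_sym; apply: (mixed w v u); rewrite // 1?eq_sym // esym.
  + exact: (dist2T u v w).
Qed.

Lemma pair_colouring_edge (V : finType) (e : rel V) (x y : V) : 3 < k -> irreflexive e ->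
  x != y -> exists a b, pair_colouring e [set x; y] a b.
Proof.
move=> k4 eirr xy; pose c i (i4 : i < 4) := Ordinal (leq_trans i4 k4).
have yx : (y == x) = false by rewrite eq_sym (negbTE xy).
exists (fun v => if v == x then @c 0 isT else @c 1 isT).
exists (fun v => if v == x then @c 2 isT else @c 3 isT); split.
- by move=> u v; rewrite !inE => /pred2P[] -> /pred2P[] ->; rewrite ?eirr ?eqxx ?yx.
- by move=> u; rewrite !inE => /pred2P[] ->; rewrite ?eqxx ?yx.
- by move=> u v w; rewrite !inE => /pred2P[] -> /pred2P[] -> /pred2P[] ->;
    rewrite ?eirr ?eqxx ?yx.
Qed.

Lemma fresh_colour (F : {set 'I_k}) : #|F| < k -> exists c, c \notin F.
Proof.
move=> Fk; apply/existsP; rewrite -negb_forall; apply: contraL Fk => /forallP F_all.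
by rewrite -leqNgt -[leqLHS]card_ord; apply/subset_leq_card/fintype.subsetP.
Qed.

Lemma distinct_fresh_colours (F1 F2 : {set 'I_k}) : #|F1| < k -> #|F2| < k ->
  (#|F1|.+1 < k) || (#|F2|.+1 < k) ->
  exists c1 c2, [/\ c1 \notin F1, c2 \notin F2 & c1 != c2].
Proof.
wlog F1k : F1 F2 / #|F1|.+1 < k => [H F1k F2k /orP[F1k'|F2k']|_ F2k _].
- by apply: H; rewrite ?F1k'.
- have [|c2 [c1 [c2F c1F c21]]] := H F2 F1 F2k' F2k F1k; first by rewrite F2k'.
  by exists c1, c2; rewrite eq_sym.
have [c2 c2F] := fresh_colour F2k.
have [|c1] := @fresh_colour (c2 |: F1).
  by apply: leq_ltn_trans F1k; rewrite cardsU1; case: (_ \notin _).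
by rewrite !inE negb_or => /andP[c12 c1F]; exists c1, c2.
Qed.

Lemma fresh_colour_seq (s : seq 'I_k) : size s < k -> exists c, c \notin s.
Proof.
move=> sk; have [|c] := @fresh_colour [set c in s].
  by apply: leq_ltn_trans sk; rewrite cardsE card_size.
by rewrite inE; exists c.
Qed.

Lemma distance2_path_colouring n (u0 u1 w0 w1 : 'I_k) : 4 < k ->
  u0 != u1 -> w0 != w1 -> u1 != w0 -> u0 != w0 -> u1 != w1 ->
  exists f, [/\ [/\ f 0 = u0, f 1 = u1, f n.+2 = w0 & f n.+3 = w1],
    forall i, i < n.+3 -> f i != f i.+1 & forall i, i < n.+2 -> f i != f i.+2].
Proof.
move=> k4; elim: n u0 u1 => [|n IH] u0 u1 u01 w01 u1w0 u0w0 u1w1.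
  exists (nth u0 [:: u0; u1; w0; w1]).
  by split=> // [[|[|[|]]]|[|[|]]].
have [c] := @fresh_colour_seq [:: u0; u1; w0; w1] k4.
rewrite !inE !negb_or => /and4P[cu0 cu1 cw0 cw1].
have [|f [[f0 f1 fw0 fw1] adj1 adj2]] := IH u1 c _ w01 cw0 u1w0 cw1.
  by rewrite eq_sym.
exists (fun i => if i is j.+1 then f j else u0); split=> [//||].
- by case=> [|i]; [rewrite f0|exact: adj1].
- by case=> [|i]; [rewrite f1 eq_sym|exact: adj2].
Qed.

Lemma compatible_path_colouring n f (c z : 'I_k) : 5 < k -> c != z ->
  exists g : nat -> 'I_k, [/\ g 0 = c, g n.+1 = z, forall i, i <= n -> g i != g i.+1 &
    forall i, i < n -> [/\ g i.+1 != f i, g i.+1 != f i.+1 & g i.+1 != f i.+2]].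
Proof.
move=> k5; elim: n f c => [|n IH] f c cz.
  by exists (fun i => if i is 0 then c else z); split=> // -[].
have [c'] := @fresh_colour_seq [:: c; z; f 0; f 1; f 2] k5.
rewrite !inE !negb_or => /and5P[c'c c'z c'0 c'1 c'2].
have [g [g0 gz step avoid]] := IH (fun i => f i.+1) c' c'z.
exists (fun i => if i is j.+1 then g j else c); split=> //.
- by case=> [|i]; [rewrite g0 eq_sym|exact: step].
- by case=> [|i]; [rewrite g0|exact: avoid].
Qed.

Definition cycle_adj (n : nat) : rel nat := fun i j =>
  [|| j == i.+1, i == j.+1, (i == 0) && (j == n) | (i == n) && (j == 0)].

Lemma pair_colouring_cycle n (a b : nat -> 'I_k) :
  (forall i, i < n -> [/\ a i != a i.+1, b i != b i.+1, a i != b i.+1 & a i.+1 != b i]) ->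
  (forall i, i <= n -> a i != b i) -> (forall i, i.+1 < n -> b i != b i.+2) ->
  [/\ a 0 != a n, b 0 != b n, a 0 != b n & a n != b 0] -> b 1 != b n -> b n.-1 != b 0 ->
  pair_colouring (cycle_adj n) [pred i | i <= n] a b.
Proof.
move=> step own dist2 [aa bb ab ba] b1n bn0; split=> [i j||i j l]; rewrite ?inE //.
  move=> i_n j_n /or4P[/eqP ji|/eqP ij|/andP[/eqP -> /eqP ->]|/andP[/eqP -> /eqP ->]].
  - by rewrite ji in j_n *; case: (step i j_n).
  - rewrite ij in i_n *; case: (step j i_n) => *; split=> //; by rewrite eq_sym.
  - by split.
  - by split; rewrite // eq_sym.
wlog il : i l / i < l => [H i_n j_n l_n i_l ij jl|i_n j_n l_n _].
  have [lt_il|lt_li|/eqP] := ltngtP i l; last by rewrite (negbTE i_l).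
    exact: H.
  rewrite eq_sym; apply: H; rewrite // 1?eq_sym //;
  by move: ij jl; rewrite /cycle_adj; lia.
move=> ij jl; have : [\/ l = i.+2, i = 1 /\ l = n | i = 0 /\ l = n.-1].
  have [E|E] := eqVneq l i.+2; first by constructor 1.
  have [i1|i1] := eqVneq i 1; [constructor 2|constructor 3];
  by move: ij jl; rewrite /cycle_adj; lia.
case=> [E|[-> ->]|[-> ->]] //; last by rewrite eq_sym.
by rewrite E; apply: dist2; lia.
Qed.

Lemma extend_edge_to_cycle n (u0 v0 u1 v1 c0 c1 : 'I_k) : 5 < k ->
  [/\ u0 != u1, v0 != v1 & u0 != v1] -> u1 != v0 -> u0 != v0 -> u1 != v1 ->
  c0 \notin [set u0; v0; v1] -> c1 \notin [set u1; v1; v0] -> c0 != c1 ->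
  exists a b, [/\ pair_colouring (cycle_adj n.+3) [pred i | i <= n.+3] a b,
    a 0 = u0 /\ b 0 = v0, a n.+3 = u1 /\ b n.+3 = v1 & b 1 = c0 /\ b n.+2 = c1].
Proof.
move=> k5 [u01 v01 u0v1] u1v0 u0v0 u1v1; rewrite !inE !negb_or.
move=> /andP[/andP[c0u0 c0v0] c0v1] /andP[/andP[c1u1 c1v1] c1v0] c01.
have [||//|//||//|b [[b0 b1 bn bN] b_step b_dist2]] :=
  @distance2_path_colouring n v0 c0 c1 v1.
- exact: ltnW.
- by rewrite eq_sym.
- by rewrite eq_sym.
have [//|//|a [a0 aN a_step a_avoid]] := @compatible_path_colouring n.+2 b u0 u1.
exists a, b; split=> //; apply: pair_colouring_cycle; rewrite ?a0 ?aN ?b0 ?b1 ?bn ?bN //.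
- move=> i i_n; rewrite a_step // b_step //; split=> //.
    case: i i_n => [|i] i_n; first by rewrite a0 b1 eq_sym.
    by case: (a_avoid i).
  move: i_n; rewrite ltnS leq_eqVlt => /predU1P[->|/a_avoid[]//].
  by rewrite aN bn eq_sym.
- case=> [|i]; first by rewrite a0 b0.
  by rewrite ltnS leq_eqVlt => /predU1P[->|/a_avoid[]//]; rewrite aN bN.
Qed.
End PairColouring.

(* Plain [lia] is exponential in the boolean hypotheses that are cleared here. *)
Ltac natlia :=
  repeat match goal with
  | H : ?T |- _ =>
    match type of T with Prop => idtac end;
    lazymatch T with
    | is_true (leq _ _) => fail
    | is_true (andb (leq _ _) (leq _ _)) => fail
    | is_true (negb (leq _ _)) => fail
    | is_true (negb (eq_op _ _)) => fail
    | is_true (negb (andb (leq _ _) (leq _ _))) => fail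
    | ~ is_true (leq _ _) => fail
    | _ \/ _ => fail
    | @eq nat _ _ => fail
    | _ => clear H
    end
  end; lia.

Section OrderedGraph.
Variables (G : sgraph) (pos : G -> nat).
Hypothesis pos_inj : injective pos.
Implicit Types (h l p q u v w x y z : G) (S : {set G}).

Definition noncrossing := forall p q x y,
  pos p < pos q < pos x -> pos x < pos y -> adj p x -> adj q y -> False.

Definition between x y := [set z | pos x < pos z < pos y].

Definition next_in S x y :=
  [&& x \in S, y \in S, pos x < pos y & [disjoint S & between x y]].

Definition chord S x y :=
  [&& x \in S, y \in S, adj x y, pos x < pos y & ~~ [disjoint S & between x y]].

Definition strictly_inside x y p q :=
  [&& pos p <= pos x, pos y <= pos q & (x, y) != (p, q)].

Definition leaf_chord S x y :=
  chord S x y /\ forall p q, chord S p q -> ~~ strictly_inside p q x y.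

Definition degree_in S v := #|neighbours v :&: S|.

(* [S] carries a cycle that visits it in the order of [pos]. *)
Definition polygon S h l :=
  [/\ [/\ h \in S, l \in S & adj h l], {in S, forall v, pos h <= pos v <= pos l} &
      forall u v, next_in S u v -> adj u v].

Lemma adj_chordVnext S x y : x \in S -> y \in S -> adj x y -> pos x < pos y ->
  chord S x y || next_in S x y.
Proof. by move=> xS yS xy x_y; rewrite /chord /next_in xS yS xy x_y /= orNb. Qed.

Lemma disjoint_between_leq S x y z : [disjoint S & between x y] -> z \in S ->
  pos x < pos z -> pos y <= pos z.
Proof.
move=> dis zS xz; rewrite leqNgt; apply/negP => zy.
by have := disjointFr dis zS; rewrite inE xz zy.
Qed.

Lemma strictly_inside_lt x y p q : pos x < pos y -> strictly_inside x y p q ->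
  pos y - pos x < pos q - pos p.
Proof.
move=> xy /and3P[px yq]; apply: contraNltn => wide.
by apply/eqP; congr (_, _); apply: pos_inj; natlia.
Qed.

Lemma card_le1_pos (A : {set G}) :
  {in A &, forall x y, ~ pos x < pos y} -> #|A| <= 1.
Proof.
move=> A_lt; apply/card_le1_eqP => x y xA yA; apply: pos_inj.
by have [/(A_lt _ _ xA yA)|/(A_lt _ _ yA xA)|] := ltngtP (pos x) (pos y).
Qed.

Lemma card_prev_le1 S v : #|[set w | next_in S w v]| <= 1.
Proof.
apply: card_le1_pos => x y; rewrite !inE => /and4P[_ _ _ dis] /and4P[yS _ yv _] xy.
by have := disjoint_between_leq dis yS xy; rewrite leqNgt yv.
Qed.

Lemma card_next_le1 S v : #|[set w | next_in S v w]| <= 1.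
Proof.
apply: card_le1_pos => x y; rewrite !inE => /and4P[_ xS vx _] /and4P[_ _ _ dis] xy.
by have := disjoint_between_leq dis xS vx; rewrite leqNgt xy.
Qed.

Section NestedLeaves.
Variables (S : {set G}) (p q : G).
Hypothesis pq : chord S p q.
Hypothesis inner_leaf :
  forall x y, chord S x y -> strictly_inside x y p q -> leaf_chord S x y.
Hypothesis noncr : noncrossing.

Lemma card_left_chords_le1 v : pos v < pos q ->
  #|[set w | chord S w v && (pos p <= pos w)]| <= 1.
Proof.
move=> vq; apply: card_le1_pos => x y; rewrite !inE => /andP[cx px] /andP[cy _] xy.
have [_ /(_ _ _ cy) /negP] : leaf_chord S x v.
  apply: inner_leaf => //; apply/and3P; split; [by []|exact: ltnW|].
  by apply: contraTneq vq => -[_ ->]; rewrite ltnn.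
apply; apply/and3P; split; [exact: ltnW|by []|].
by apply: contraTneq xy => -[->]; rewrite ltnn.
Qed.

Lemma card_right_chords_le1 v : pos p < pos v ->
  #|[set w | chord S v w && (pos w <= pos q)]| <= 1.
Proof.
move=> pv; apply: card_le1_pos => x y; rewrite !inE => /andP[cx _] /andP[cy yq] xy.
have [_ /(_ _ _ cx) /negP] : leaf_chord S v y.
  apply: inner_leaf => //; apply/and3P; split; [exact: ltnW|by []|].
  by apply: contraTneq pv => -[-> _]; rewrite ltnn.
apply; apply/and3P; split; [by []|exact: ltnW|].
by apply: contraTneq xy => -[->]; rewrite ltnn.
Qed.

Lemma nested_leaf_degree v : v \in S -> pos p < pos v < pos q -> degree_in S v <= 4.
Proof.
move=> vS /andP[pv vq]; have /and5P[_ _ pq_adj _ _] := pq.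
have sub : neighbours v :&: S \subset
    ([set w | next_in S w v] :|: [set w | chord S w v && (pos p <= pos w)]) :|:
    ([set w | next_in S v w] :|: [set w | chord S v w && (pos w <= pos q)]).
  apply/fintype.subsetP => w; rewrite !inE => /andP[vw wS].
  have [wv|wv|/pos_inj E] := ltngtP (pos w) (pos v); last by rewrite E adj_irrefl in vw.
  - have pw : pos p <= pos w.
      rewrite leqNgt; apply/negP => wp.
      by apply: (noncr (p := w) (q := p) (x := v) (y := q)); rewrite ?wp ?pv // adj_sym.
    rewrite adj_sym in vw; rewrite pw andbT orbA.
    by have /orP[->|->] := adj_chordVnext wS vS vw wv; rewrite ?orbT.
  - have wq : pos w <= pos q.
      rewrite leqNgt; apply/negP => qw.
      by apply: (noncr (p := p) (q := v) (x := q) (y := w)); rewrite ?pv.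
    by have /orP[->|->] := adj_chordVnext vS wS vw wv; rewrite ?wq ?orbT.
apply: leq_trans (subset_leq_card sub) _.
rewrite !cardsU; have := card_prev_le1 S v; have := card_left_chords_le1 vq.
by have := card_next_le1 S v; have := card_right_chords_le1 pv; natlia.
Qed.
End NestedLeaves.

Lemma exists_low_degree_leaf S h l : noncrossing -> chord S h l ->
  exists x y, leaf_chord S x y /\
    [\/ (x, y) = (h, l), degree_in S x <= 4 | degree_in S y <= 4].
Proof.
move=> noncr hl; pose nonleaf c := chord S c.1 c.2 && [exists d : G * G, chord S d.1 d.2 &&
  strictly_inside d.1 d.2 c.1 c.2].
have [c0 c0_nonleaf|all_leaf] := pickP nonleaf; last first.
  exists h, l; split; last by constructor 1.
  split=> // x y xy; apply/negP => inside.
  have := all_leaf (h, l); rewrite /nonleaf hl => /negbT /existsP[]; exists (x, y).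
  by rewrite xy.
have [[p q] /andP[/= pq /existsP[[x y] /= /andP[xy xy_in]]] pq_min] :=
  arg_minnP (fun c => pos c.2 - pos c.1) c0_nonleaf.
have inner_leaf u v : chord S u v -> strictly_inside u v p q -> leaf_chord S u v.
  move=> uv uv_in; split=> // u' v' uv'; apply/negP => inside.
  have /pq_min /= : nonleaf (u, v).
    by rewrite /nonleaf uv; apply/existsP; exists (u', v'); rewrite uv'.
  by have /and5P[_ _ _ u_lt_v _] := uv; have := strictly_inside_lt u_lt_v uv_in; natlia.
exists x, y; split; first exact: inner_leaf.
have /and5P[xS yS _ x_lt_y _] := xy; have /and3P[px yq xy_neq] := xy_in.
have [px'|xp] := ltnP (pos p) (pos x).
  by constructor 2; apply: (nested_leaf_degree pq) => //; rewrite px' (leq_trans x_lt_y).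
constructor 3; apply: (nested_leaf_degree pq) => //; rewrite (leq_ltn_trans px) //=.
rewrite ltn_neqAle yq andbT; apply: contraNneq xy_neq => /pos_inj ->.
by apply/eqP; congr (_, _); apply/pos_inj/eqP; rewrite eqn_leq xp.
Qed.

Lemma polygon_outer S h l : polygon S h l -> S :\: between h l = [set h; l].
Proof.
move=> [[hS lS _] bounds _]; apply/setP => v; rewrite !inE.
apply/andP/pred2P => [[out vS]|[]->]; rewrite ?ltnn ?andbF //.
have [/pos_inj|/pos_inj] : pos v = pos h \/ pos v = pos l.
- by have := bounds v vS; natlia.
- by left.
- by right.
Qed.

Lemma polygon_remove_between S h l x y : polygon S h l -> x \in S -> y \in S -> adj x y ->
  polygon (S :\: between x y) h l.
Proof.
move=> [[hS lS hl] bounds edge] xS yS xy; split.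
- by rewrite !inE hS lS; have := bounds x xS; have := bounds y yS; split=> //; natlia.
- by move=> v; rewrite inE => /andP[_ /bounds].
- move=> u v /and4P[]; rewrite !inE => /andP[u_out uS] /andP[v_out vS] uv dis.
  have [dis_uv|] := boolP [disjoint S & between u v].
    by apply: edge; rewrite /next_in uS vS uv.
  case/pred0Pn => z /andP[/= zS]; rewrite inE => /andP[uz zv].
  have xzy : pos x < pos z < pos y.
    apply: contraT => z_out; have := disjointFr dis (x := z).
    by rewrite !inE z_out zS uz zv => /(_ isT).
  have xD : x \in S :\: between x y by rewrite !inE ltnn xS.
  have yD : y \in S :\: between x y by rewrite !inE ltnn andbF yS.
  have xu : ~ pos u < pos x by move=> /(disjoint_between_leq dis xD); natlia.
  have yv : ~ pos y < pos v.
    by have := disjointFr dis yD; rewrite inE => /negbT; natlia.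
  suff [-> ->] : u = x /\ v = y by [].
  by split; apply: pos_inj; natlia.
Qed.

Lemma exists_next S x y : x \in S -> y \in S -> pos x < pos y ->
  exists2 z, next_in S x z & pos z <= pos y.
Proof.
move=> xS yS xy.
have [|z /andP[zS xz] z_min] := @arg_minnP _ y [pred z | (z \in S) && (pos x < pos z)] pos.
  by rewrite /= yS.
exists z; last by apply: z_min; rewrite /= yS.
rewrite /next_in xS zS xz disjoint_subset; apply/fintype.subsetP => w wS.
rewrite !inE; apply/negP => /andP[xw]; rewrite ltnNge => /negP; apply.
by apply: z_min; rewrite /= wS.
Qed.

Lemma exists_prev S x y : x \in S -> y \in S -> pos x < pos y ->
  exists2 z, next_in S z y & pos x <= pos z.
Proof.
move=> xS yS xy.
have [|z /andP[zS zy] z_max] := @arg_maxnP _ x [pred z | (z \in S) && (pos z < pos y)] pos.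
  by rewrite /= xS.
exists z; last by apply: z_max; rewrite /= xS.
rewrite /next_in zS yS zy disjoint_subset; apply/fintype.subsetP => w wS.
rewrite !inE; apply/negP => /andP[+ wy]; rewrite ltnNge => /negP; apply.
by apply: z_max; rewrite /= wS.
Qed.

Lemma degree_in_setD S (B : {set G}) v z : z \in S :&: B -> adj v z ->
  degree_in (S :\: B) v < degree_in S v.
Proof.
rewrite inE => /andP[zS zB] vz; apply/proper_card/properP; split.
  by rewrite finset.setIS // finset.subsetDl.
by exists z; rewrite !inE vz ?zS // zB.
Qed.

Lemma degree_in_le_max S v : degree_in S v <= max_degree G.
Proof.
apply: leq_trans (leq_bigmax v); exact/subset_leq_card/finset.subsetIl.
Qed.

Section Face.
Variables (S : {set G}) (h l x y : G).
Hypotheses (noncr : noncrossing) (tri : triangle_free G).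
Hypotheses (poly : polygon S h l) (leaf : leaf_chord S x y).

Let inner := S :&: between x y.
Let rest := S :\: between x y.
Let face := [set z in S | pos x <= pos z <= pos y].

Definition rank z := #|[set w in face | pos w < pos z]|.

Let xS : x \in S. Proof. by case: leaf => /and5P[]. Qed.
Let yS : y \in S. Proof. by case: leaf => /and5P[]. Qed.
Let xy_adj : adj x y. Proof. by case: leaf => /and5P[]. Qed.
Let xy : pos x < pos y. Proof. by case: leaf => /and5P[]. Qed.

Let xface : x \in face. Proof. by rewrite inE xS leqnn ltnW. Qed.
Let yface : y \in face. Proof. by rewrite inE yS leqnn ltnW. Qed.

Lemma face_ends : exists z t, [/\ z \in inner, t \in inner, adj x z, adj t y & z != t].
Proof.
have [_ _ edge] := poly; have /and5P[_ _ _ _ /negP nodis] : chord S x y by case: leaf.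
have [z xz zy] := exists_next xS yS xy; have [t ty xt] := exists_prev xS yS xy.
have [/and4P[_ zS x_lt_z dis_z] /and4P[tS _ t_lt_y dis_t]] := (xz, ty).
exists z, t; split; last 1 first.
- by apply/eqP => zt; apply: (tri (edge _ _ xz) _ xy_adj); rewrite zt; exact: edge.
- rewrite !inE zS x_lt_z ltn_neqAle zy andbT; apply/eqP => /pos_inj E.
  by apply: nodis; rewrite -E.
- rewrite !inE tS t_lt_y andbT ltn_neqAle xt andbT; apply/eqP => /pos_inj E.
  by apply: nodis; rewrite E.
- exact: edge.
- exact: edge.
Qed.

Lemma inner_card : 1 < #|inner|.
Proof. by have [z [t [zI tI _ _ zt]]] := face_ends; apply/card_gt1P; exists z, t. Qed.

Lemma degree_rest_left : degree_in rest x < degree_in S x.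
Proof. by have [z [t [zI _ xz _ _]]] := face_ends; exact: degree_in_setD xz. Qed.

Lemma degree_rest_right : degree_in rest y < degree_in S y.
Proof.
have [z [t [_ tI _ ty _]]] := face_ends.
by apply: degree_in_setD tI _; rewrite adj_sym.
Qed.

Lemma face_adj u v : u \in face -> v \in face -> adj u v -> pos u < pos v ->
  next_in S u v \/ u = x /\ v = y.
Proof.
rewrite !inE => /andP[uS /andP[xu _]] /andP[vS /andP[_ vy]] uv_adj uv.
case/orP: (adj_chordVnext uS vS uv_adj uv); last by left.
case: leaf => _ /[apply]; rewrite /strictly_inside xu vy negbK => /eqP[-> ->].
by right.
Qed.

Lemma rank_ltn u v : u \in face -> pos u < pos v -> rank u < rank v.
Proof.
move=> uF uv; apply/proper_card/properP; split.
  by apply/fintype.subsetP => w; rewrite !inE => /andP[-> /ltn_trans ->].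
by exists u; rewrite inE ?ltnn ?andbF ?uF.
Qed.

Lemma rank_inj : {in face &, injective rank}.
Proof.
move=> u v uF vF E; apply: pos_inj.
by have [/(rank_ltn uF)|/(rank_ltn vF)|] := ltngtP (pos u) (pos v); rewrite ?E ?ltnn.
Qed.

Lemma rank_left : rank x = 0.
Proof.
apply: eq_card0 => w; rewrite !inE; apply/negbTE/negP.
by rewrite ltnNge => /andP[/and3P[_ -> _]].
Qed.

Lemma rank_next u v : u \in face -> next_in S u v -> rank v = (rank u).+1.
Proof.
move=> uF /and4P[_ _ uv dis].
have -> : rank v = #|u |: [set w in face | pos w < pos u]|.
  apply: eq_card => w; rewrite !inE; have [->|wu] := eqVneq w u.
    by rewrite uv andbT; move: uF; rewrite inE.
  case: (boolP (w \in S)) => //= wS; congr andb; apply/idP/idP => [wv|/ltn_trans->//].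
  have [//|uw|/pos_inj E] := ltngtP (pos w) (pos u); last by rewrite E eqxx in wu.
  by have := disjoint_between_leq dis wS uw; rewrite leqNgt wv.
by rewrite cardsU1 !inE ltnn andbF.
Qed.

Lemma rank_right : rank y = #|inner|.+1.
Proof.
have -> : rank y = #|x |: inner|.
  apply: eq_card => w; rewrite !inE; have [->|wx] := eqVneq w x.
    by rewrite xS leqnn xy ltnW.
  have wx_pos : pos w != pos x by apply: contra_neq wx; exact: pos_inj.
  by case: (w \in S) => //=; rewrite [pos x < _]ltn_neqAle eq_sym wx_pos /=; natlia.
by rewrite cardsU1 !inE ltnn andbF.
Qed.

Lemma face_cycle_adj :
  {in face &, forall u v, adj u v -> cycle_adj (rank y) (rank u) (rank v)}.
Proof.
have sym i j : cycle_adj (rank y) i j -> cycle_adj (rank y) j i by rewrite /cycle_adj; lia.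
move=> u v uF vF; wlog uv : u v uF vF / pos u < pos v => [H uv_adj|uv_adj].
  have [uv|vu|/pos_inj E] := ltngtP (pos u) (pos v); first exact: H.
    by apply/sym/H; rewrite // adj_sym.
  by rewrite E adj_irrefl in uv_adj.
have [/(rank_next uF) ->|[-> ->]] := face_adj uF vF uv_adj uv.
  by rewrite /cycle_adj eqxx.
by rewrite /cycle_adj rank_left !eqxx !orbT.
Qed.

Lemma face_cases v : v \in face -> [\/ v = x, v = y | v \in inner].
Proof.
rewrite !inE => /andP[vS /andP[xv vy]].
have [/pos_inj ->|xv'] := eqVneq (pos v) (pos x); first by constructor 1.
have [/pos_inj ->|vy'] := eqVneq (pos v) (pos y); first by constructor 2.
by constructor 3; rewrite vS; natlia.
Qed.

Lemma rest_face : rest :|: face = S.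
Proof.
apply/setP => v; rewrite !inE; case: (v \in S); rewrite ?andbF //= andbT.
by apply/negP; natlia.
Qed.

Lemma inner_adj u v : u \in inner -> v \in S -> adj u v -> v \in face.
Proof.
rewrite !inE => /andP[uS /andP[xu uy]] vS uv; rewrite vS /=.
apply/andP; split; rewrite leqNgt; apply/negP => out.
  by apply: (noncr (p := v) (q := x) (x := u) (y := y)); rewrite ?out // adj_sym.
by apply: (noncr (p := x) (q := u) (x := y) (y := v)); rewrite ?xu.
Qed.

Lemma inner_face w : w \in inner -> w \in face.
Proof. by rewrite !inE => /andP[-> /andP[/ltnW -> /ltnW ->]]. Qed.

Lemma rank_after_left w : w \in inner -> adj x w -> rank w = 1.
Proof.
move=> wI xw; have := wI; rewrite !inE => /and3P[_ x_lt_w w_lt_y].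
have [/(rank_next xface) ->|[_ E]] := face_adj xface (inner_face wI) xw x_lt_w.
  by rewrite rank_left.
by rewrite E ltnn in w_lt_y.
Qed.

Lemma rank_before_right w : w \in inner -> adj y w -> rank w = (rank y).-1.
Proof.
move=> wI; rewrite adj_sym => wy; have := wI; rewrite !inE => /and3P[_ x_lt_w w_lt_y].
have [/(rank_next (inner_face wI)) ->//|[E _]] := face_adj (inner_face wI) yface wy w_lt_y.
by rewrite E ltnn in x_lt_w.
Qed.

Lemma rank_le v : v \in face -> rank v <= rank y.
Proof.
move=> vF; have := vF; rewrite !inE => /and3P[_ _].
by rewrite leq_eqVlt => /predU1P[/pos_inj ->//|/(rank_ltn vF)/ltnW].
Qed.

Lemma face_colouring_glue k (a b : G -> 'I_k) (f g : nat -> 'I_k) :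
  pair_colouring (@adj G) rest a b ->
  pair_colouring (cycle_adj (rank y)) [pred i | i <= rank y] f g ->
  f 0 = a x /\ g 0 = b x -> f (rank y) = a y /\ g (rank y) = b y ->
  {in neighbours x :&: rest, forall v, b v != g 1} ->
  {in neighbours y :&: rest, forall v, b v != g (rank y).-1} ->
  exists a' b' : G -> 'I_k, pair_colouring (@adj G) S a' b'.
Proof.
move=> ab fg [f0 g0] [fy gy] g1 gy'.
pose mix (c : G -> 'I_k) (d : nat -> 'I_k) v :=
  if v \in between x y then d (rank v) else c v.
have on_rest c d : {in rest, c =1 mix c d}.
  by move=> v; rewrite /mix inE => /andP[/negbTE ->].
have on_face c d : d 0 = c x -> d (rank y) = c y -> {in face, d \o rank =1 mix c d}.
  move=> d0 dy v; rewrite /mix => /face_cases[->|->|]; last first.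
  - by rewrite inE => /andP[_ ->].
  - by rewrite /= inE ltnn andbF.
  - by rewrite /= inE ltnn rank_left.
have innerD w : w \in face :\: rest -> w \in inner.
  by rewrite !inE => /andP[+ /andP[wS _]]; rewrite wS andbT negbK.
exists (mix a f), (mix b g); rewrite -rest_face; apply: pair_colouring_glue.
- exact: adj_sym.
- exact: eq_in_pair_colouring (on_rest _ _) (on_rest _ _) ab.
- apply: (eq_in_pair_colouring (on_face _ _ f0 fy) (on_face _ _ g0 gy)).
  exact: pair_colouring_pullback rank_le rank_inj face_cycle_adj fg.
- move=> u v /finset.setDP[uR uF] /innerD vI; have /finset.setDP[uS _] := uR.
  by rewrite adj_sym; apply: contra uF; exact: inner_adj vI uS.
- move=> u v w /finset.setDP[uR _] vD /innerD wI uv vw.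
  rewrite -(on_rest b g u uR) -(on_face b g g0 gy w (inner_face wI)) /=.
  have : v = x \/ v = y.
    move: vD; rewrite inE => /andP[vR /face_cases[->|->|]]; [by left|by right|].
    by move: vR; rewrite !inE => /andP[/negbTE ->]; rewrite andbF.
  case=> E; rewrite E in uv vw.
    by rewrite (rank_after_left wI vw); apply: g1; rewrite finset.in_setI uR inE adj_sym uv.
  by rewrite (rank_before_right wI vw); apply: gy'; rewrite finset.in_setI uR inE adj_sym uv.
Qed.

Definition forbidden k (a b : G -> 'I_k) v : {set 'I_k} :=
  a v |: (b v |: b @: (neighbours v :&: rest)).

Lemma forbidden_card k (a b : G -> 'I_k) v : #|forbidden a b v| <= degree_in rest v + 2.
Proof.
rewrite !cardsU1 addnA [leqRHS]addnC; apply: leq_add; first by do 2!case: (_ \notin _).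
exact: leq_imset_card.
Qed.

Lemma extend_pair_colouring k (a b : G -> 'I_k) : 5 < k ->
  pair_colouring (@adj G) rest a b ->
  degree_in rest x + 2 < k -> degree_in rest y + 2 < k ->
  (degree_in rest x + 3 < k) || (degree_in rest y + 3 < k) ->
  exists a' b' : G -> 'I_k, pair_colouring (@adj G) S a' b'.
Proof.
move=> k5 ab dx dy dxy; have [edge own _] := ab.
have [cx cy] := (forbidden_card a b x, forbidden_card a b y).
have [|||c0 [c1 [c0F c1F c01]]] :=
  @distinct_fresh_colours k (forbidden a b x) (forbidden a b y).
- exact: leq_ltn_trans dx.
- exact: leq_ltn_trans dy.
- by move: dxy; natlia.
have [xR yR] : x \in rest /\ y \in rest by rewrite !inE ltnn xS ltnn andbF yS.
have [axy bxy axby] := edge x y xR yR xy_adj.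
have [_ _ aybx] := edge y x yR xR (etrans (adj_sym _ _) xy_adj).
have nbr u v : u \in rest -> adj v u -> b u \in b @: (neighbours v :&: rest).
  by move=> uR vu; apply: imset_f; rewrite inE uR inE vu.
have [n nE] : exists n, rank y = n.+3.
  by exists (#|inner| - 2); rewrite rank_right; have := inner_card; natlia.
have [|||||f [g [fg [f0 g0] [fy gy] [g1 gy']]]] :=
  @extend_edge_to_cycle k n (a x) (b x) (a y) (b y) c0 c1 k5 (And3 axy bxy axby) aybx;
  rewrite ?own //.
- move: c0F; rewrite !inE !negb_or => /and3P[-> -> nb] /=.
  by apply: contraNneq nb => ->; apply: nbr => //.
- move: c1F; rewrite !inE !negb_or => /and3P[-> -> nb] /=.
  by apply: contraNneq nb => ->; apply: nbr; rewrite // adj_sym.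
apply: (face_colouring_glue ab (f := f) (g := g)); rewrite ?nE //.
- move=> v vN; rewrite g1; apply: contraNneq c0F => <-.
  by rewrite !inE imset_f ?orbT.
- move=> v vN; rewrite /= gy'; apply: contraNneq c1F => <-.
  by rewrite !inE imset_f ?orbT.
Qed.
End Face.

Lemma polygon_pair_colouring k S h l : noncrossing -> triangle_free G ->
  4 < max_degree G -> max_degree G + 2 <= k -> polygon S h l ->
  exists a b : G -> 'I_k, pair_colouring (@adj G) S a b.
Proof.
move=> noncr tri D4 Dk; have [n] := ubnP #|S|; elim: n S => // n IH S Sn poly.
have [[hS lS hl] bounds _] := poly.
have hl_lt : pos h < pos l.
  have /andP[] := bounds l lS; rewrite leq_eqVlt => /predU1P[/pos_inj E|//].
  by rewrite E adj_irrefl in hl.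
have [hl_chord|] := boolP (chord S h l); last first.
  rewrite /chord hS lS hl hl_lt /= negbK => dis.
  have -> : S = [set h; l] by rewrite -(polygon_outer poly); apply/esym/finset.setDidPl.
  apply: pair_colouring_edge; [natlia|exact: adj_irrefl|exact: adj_neq].
have [x [y [leaf low]]] := exists_low_degree_leaf noncr hl_chord.
have /and5P[xS yS xy_adj _ /pred0Pn[z /andP[/= zS zB]]] := leaf.1.
have [|a [b ab]] := IH (S :\: between x y) _ (polygon_remove_between poly xS yS xy_adj).
  move: Sn; rewrite ltnS; apply/leq_trans/proper_card/properP; split.
    exact: finset.subsetDl.
  by exists z; rewrite // inE zB.
have [Dx Dy] := (degree_in_le_max S x, degree_in_le_max S y).
have dx := degree_rest_left tri poly leaf; have dy := degree_rest_right tri poly leaf.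
apply: (extend_pair_colouring noncr tri poly leaf _ ab); try natlia.
case: low => [[xh yl]|low|low]; try natlia.
rewrite xh yl in dx dy *.
have : degree_in (S :\: between h l) h <= 2; last by natlia.
rewrite polygon_outer //; apply: leq_trans (subset_leq_card (finset.subsetIr _ _)) _.
by rewrite cards2; case: (_ != _).
Qed.
End OrderedGraph.

Section HamiltonianColouring.
Variables (G : sgraph) (s : seq G).
Hypotheses (cyc : cycle (@adj G) s) (us : uniq s) (all_s : forall v, v \in s).

Let pos v := index v s.

Lemma index_noncrossing : K23_minor_free G -> triangle_free G -> noncrossing pos.
Proof.
move=> free tri p q x y /andP[pq qx] xy px qy.
have split v w : pos v < pos w ->
    drop (pos v) s = v :: take (pos w - (pos v).+1) (drop (pos v).+1 s) ++ drop (pos w) s.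
  move=> vw; rewrite (drop_nth v) ?index_mem // nth_index //; congr (_ :: _).
  by rewrite -{1}(cat_take_drop (pos w - (pos v).+1) (drop (pos v).+1 s)) drop_drop subnK.
have split_last v : drop (pos v) s = v :: drop (pos v).+1 s.
  by rewrite (drop_nth v) ?index_mem // nth_index.
have := rot_uniq (pos p) s; have := rot_cycle (pos p) (@adj G) s.
rewrite cyc us /rot (split p q) // (split q x) // (split x y) // split_last.
rewrite /= -!catA /= -!catA /= -!catA /= => cyc' us'.
exact: (triangle_free_no_crossing_chords free tri cyc' us' px qy).
Qed.

Lemma index_polygon : 1 < size s -> exists h l, polygon pos [set: G] h l.
Proof.
move=> s1; have [h [t E]] : exists h t, s = h :: t by case: (s) s1 => // h t; exists h, t.
have le_pos w : pos w <= size t by have := all_s w; rewrite -index_mem {2}E.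
have pos_h : pos h = 0 by rewrite /pos E /= eqxx.
have pos_l : pos (last h t) = size t.
  by rewrite /pos (last_nth h) -E index_uniq // E.
have /andP[ht lh] : path (@adj G) h t && adj (last h t) h.
  by move: cyc; rewrite E /= rcons_path.
exists h, (last h t); split; first by rewrite !inE adj_sym.
  by move=> v _; rewrite pos_h pos_l le_pos.
move=> u v /and4P[_ _ uv dis].
have next_u : pos u < size t := leq_trans uv (le_pos v).
have next_s : (pos u).+1 < size s by rewrite [in ltnRHS]E.
have pos_v : pos v = (pos u).+1.
  apply/eqP; rewrite eqn_leq uv andbT leqNgt; apply/negP => gap.
  have := disjointFr dis (finset.in_setT (nth h s (pos u).+1)).
  by rewrite inE [pos (nth _ _ _)]index_uniq // ltnSn gap.
have /(pathP h) /(_ _ next_u) := ht.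
by rewrite -E -[nth h t _]/(nth h (h :: t) (pos u).+1) -E -pos_v !nth_index.
Qed.

Lemma hamiltonian_pair_colouring : 1 < size s -> K23_minor_free G -> triangle_free G ->
  4 < max_degree G ->
  exists a b : G -> 'I_(max_degree G + 2), pair_colouring (@adj G) [set: G] a b.
Proof.
move=> s1 free tri D4; have [h [l poly]] := index_polygon s1.
have pos_inj : injective pos by move=> u v; exact: index_inj.
exact: (polygon_pair_colouring pos_inj (index_noncrossing free tri) tri D4 _ poly).
Qed.
End HamiltonianColouring.

Lemma set2_inj (T : finType) (u v w : T) : u != v -> u != w -> [set u; v] = [set u; w] -> v = w.
Proof.
move=> uv uw /setP /(_ v); rewrite !inE eqxx orbT eq_sym (negbTE uv) /=.
by move/esym/eqP.
Qed.

Section Incidences.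
Variable G : sgraph.
Implicit Types (u v w : G) (i j : incidence G) (x y z : vi_elt G).

Definition source i : G := (val i).1.

Definition target i : G := odflt (source i) [pick w in (val i).2 :\ source i].

Lemma incidenceP i : adj (source i) (target i) /\ (val i).2 = [set source i; target i].
Proof.
have /andP[/imsetP[[p q]]] := valP i; rewrite inE /= -/(source i) => pq E.
have targetE u v : u != v -> (val i).2 = [set u; v] -> source i = u -> target i = v.
  move=> uv Euv iu; rewrite /target iu Euv; case: pickP => [w|/(_ v)] /=; rewrite !inE.
    by case/andP => /negbTE -> /eqP.
  by rewrite eqxx orbT eq_sym uv.
have pq_neq := adj_neq pq; rewrite E !inE => /pred2P[] iE.
  by rewrite iE (targetE p q).
by rewrite iE (targetE q p) ?[[set q; p]]finset.setUC // 1?eq_sym // adj_sym.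
Qed.

Lemma source_target_adj i : adj (source i) (target i).
Proof. by case: (incidenceP i). Qed.

Lemma val_incidence i : val i = (source i, [set source i; target i]).
Proof. by rewrite [LHS]surjective_pairing; have [_ ->] := incidenceP i. Qed.

Lemma incidence_inj i j : source i = source j -> target i = target j -> i = j.
Proof. by move=> Es Et; apply: val_inj; rewrite !val_incidence Es Et. Qed.

Lemma incidence_of_adj u v : adj u v -> exists2 i, source i = u & target i = v.
Proof.
move=> uv; pose p := (u, [set u; v]); have pP : (p.2 \in edges G) && (p.1 \in p.2).
  by rewrite /= adj_edge // !inE eqxx.
pose i : incidence G := exist _ p pP; exists i => //.
have [it Ei] := incidenceP i.
exact: set2_inj (adj_neq it) (adj_neq uv) (esym Ei).
Qed.

Lemma adj_third_inrP i j :
  reflect (source j = target i /\ target j = source i) (adj_third (inr i) (inr j)).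
Proof.
rewrite /adj_third !val_incidence /=.
have [ni nj] := (adj_neq (source_target_adj i), adj_neq (source_target_adj j)).
apply: (iffP andP) => [[/eqP E ne]|[-> ->]]; last by rewrite finset.setUC eqxx ni.
have Ej : source j = target i.
  by have := finset.set21 (source j) (target j); rewrite -E !inE eq_sym (negbTE ne) => /eqP.
split=> //; have := finset.set22 (source j) (target j).
by rewrite -E !inE -Ej [target j == source j]eq_sym (negbTE nj) orbF => /eqP.
Qed.

Lemma in_I2 v i : (i \in I2 v) = (target i == v).
Proof.
have it := source_target_adj i; rewrite !inE val_incidence /=.
apply/andP/eqP => [[vi /eqP]|<-]; last by rewrite adj_sym.
by apply: set2_inj; rewrite ?adj_neq // adj_sym.
Qed.

Definition third_close (x y : vi_elt G) : Prop :=
  match x, y with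
  | inl u, inl v => u = v \/ adj u v
  | inl u, inr i | inr i, inl u => u = source i \/ u = target i
  | inr i, inr j => [\/ source i = source j, source i = target j | target i = source j]
  end.

Lemma adj_third_inl u y : adj_third (inl u) y -> exists2 i, y = inr i & source i = u.
Proof. by case: y => // i /eqP ->; exists i. Qed.

Lemma adj_third_sym : symmetric (@adj_third G).
Proof. by move=> [u|i] [v|j] //=; rewrite eq_sym [X in _ && ~~ X]eq_sym. Qed.

Lemma dist_third_le_sym d x y : dist_third_le d x y -> dist_third_le d y x.
Proof.
move=> [s [xs <- sd]]; exists (rev (belast x s)); split.
- by rewrite rev_path; apply: sub_path xs => a b; rewrite adj_third_sym.
- by case: s {xs sd} => //= z s; rewrite rev_cons last_rcons.
- by rewrite size_rev size_belast.
Qed.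

Lemma adj_third_inr_cases i z : adj_third (inr i) z ->
  z = inl (source i) \/ exists2 j, z = inr j & source j = target i /\ target j = source i.
Proof.
by case: z => [v /eqP ->|j /adj_third_inrP]; [left|right; exists j].
Qed.

Lemma dist_third_le3_vertex u y : dist_third_le 3 (inl u) y -> third_close (inl u) y.
Proof.
case=> s [+ <- +]; case: s => [|z [|w [|t [|? ?]]]] //= + _; first by left.
- by rewrite andbT => /adj_third_inl[i -> <-]; left.
- case/and3P=> /adj_third_inl[i -> <-] /adj_third_inr_cases[->|[j -> [_ <-]]] _.
    by left.
  by right.
- case/and4P=> /adj_third_inl[i -> <-] /adj_third_inr_cases[->|[j -> [ji <-]]] /=.
    by case/adj_third_inl=> j -> <-; left.
  case/adj_third_inr_cases=> [->|[j' -> [-> _]]] _; last by left.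
  by right; rewrite adj_sym source_target_adj.
Qed.

Lemma dist_third_le3_incidence i j :
  dist_third_le 3 (inr i) (inr j) -> third_close (inr i) (inr j).
Proof.
case=> s []; case: s => [|z [|w [|t [|? ?]]]] //= + + _.
- by move=> _ [->]; constructor 1.
- by rewrite andbT => + zj; rewrite zj => /adj_third_inrP[_ ->]; constructor 2.
- move=> /and3P[/adj_third_inr_cases[->|[i' -> [_ <-]]] + _] wj; rewrite wj.
    by case/adj_third_inl=> _ [<-] ->; constructor 1.
  by case/adj_third_inrP=> ->; constructor 1.
- move=> /and4P[/adj_third_inr_cases[->|[i' -> [i't <-]]] + + _] tj; rewrite tj.
    by move=> /adj_third_inl[i' -> <-] /adj_third_inrP[_ ->]; constructor 2.
  case/adj_third_inr_cases=> [->|[j' -> [_ j't]]].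
    by case/adj_third_inl=> _ [<-]; rewrite i't => ->; constructor 3.
  by case/adj_third_inrP=> ->; rewrite j't i't; constructor 3.
Qed.

Lemma dist_third_le3_close x y : dist_third_le 3 x y -> third_close x y.
Proof.
case: x y => [u|i] y; first exact: dist_third_le3_vertex.
case: y => [v|j]; last exact: dist_third_le3_incidence.
by move/dist_third_le_sym/dist_third_le3_vertex.
Qed.

Lemma third_close_dist x y : third_close x y -> dist_third_le 3 x y.
Proof.
have /choice[opp oppE] i : exists j, source j = target i /\ target j = source i.
  have [|j js jt] := @incidence_of_adj (target i) (source i).
    by rewrite adj_sym source_target_adj.
  by exists j.
have to_opp i : adj_third (inr i) (inr (opp i)) by apply/adj_third_inrP.
have from_opp i : adj_third (inr (opp i)) (inr i) by rewrite adj_third_sym.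
have from_source i : adj_third (inl (source i)) (inr i) by exact: eqxx.
have to_source i : adj_third (inr i) (inl (source i)) by exact: eqxx.
have from_target i : adj_third (inl (target i)) (inr (opp i)) by rewrite -(oppE i).1.
have to_target i : adj_third (inr (opp i)) (inl (target i)) by rewrite adj_third_sym.
have vertex_inc u i : u = source i \/ u = target i -> dist_third_le 3 (inl u) (inr i).
  case=> ->; first by exists [:: inr i]; rewrite /path from_source.
  by exists [:: inr (opp i); inr i]; rewrite /path from_target from_opp.
case: x y => [u|i] [v|j]; [|exact: vertex_inc|by move/vertex_inc/dist_third_le_sym|].
  case=> [->|/incidence_of_adj[i <- <-]]; first by exists [::].
  exists [:: inr i; inr (opp i); inl (target i)].
  by rewrite /path from_source to_opp to_target.
case=> E.
- by exists [:: inl (source i); inr j]; rewrite /path to_source E from_source.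
- exists [:: inl (source i); inr (opp j); inr j].
  by rewrite /path to_source E from_target from_opp.
- exists [:: inr (opp i); inl (target i); inr j].
  by rewrite /path to_opp to_target E from_source.
Qed.

Lemma vi_coloring_third_close k (c : vi_elt G -> 'I_k) :
  vi_coloring c <-> forall x y, x != y -> third_close x y -> c x != c y.
Proof.
by split=> h x y xy ?; apply: h => //;
  [exact: third_close_dist|exact: dist_third_le3_close].
Qed.

Lemma vi_ks_coloring_of_pair k (a b : G -> 'I_k) :
  pair_colouring (@adj G) [set: G] a b -> exists c : vi_elt G -> 'I_k, vi_ks_coloring 1 c.
Proof.
move=> [edge own dist2]; pose c (x : vi_elt G) :=
  match x with inl u => a u | inr i => b (target i) end.
have {}edge u v : adj u v -> [/\ a u != a v, b u != b v & a u != b v].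
  by apply: edge; rewrite inE.
have {}own u : a u != b u by apply: own; rewrite inE.
have {}dist2 u v w : u != w -> adj u v -> adj v w -> b u != b w.
  by apply: dist2; rewrite inE.
have ab i : a (source i) != b (target i) by case: (edge _ _ (source_target_adj i)).
have bb i : b (source i) != b (target i) by case: (edge _ _ (source_target_adj i)).
exists c; split; last first.
  move=> v; rewrite -(cards1 (b v)); apply/subset_leq_card/fintype.subsetP => z.
  by case/imsetP => i; rewrite in_I2 => /eqP iv ->; rewrite inE /= iv.
apply/vi_coloring_third_close => -[u|i] [v|j] xy /=.
- by case=> [uv|/edge[]//]; rewrite uv eqxx in xy.
- by case=> ->; [exact: ab|exact: own].
- by case=> ->; rewrite eq_sym; [exact: ab|exact: own].
- case=> E.
  + apply: (dist2 _ (source i)); rewrite 1?adj_sym ?source_target_adj //.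
      by apply: contra_neq xy => Et; congr inr; exact: incidence_inj.
    by rewrite adj_sym E source_target_adj.
  + by rewrite -E eq_sym; exact: bb.
  + by rewrite E; exact: bb.
Qed.

Lemma neighbours_target v : neighbours v = target @: [set i | source i == v].
Proof.
apply/setP => w; rewrite inE; apply/idP/imsetP => [/incidence_of_adj[i iv iw]|[i]].
  by exists i; rewrite // inE iv.
by rewrite inE => /eqP <- ->; exact: source_target_adj.
Qed.

Lemma vi_coloring_degree k (c : vi_elt G -> 'I_k) v : vi_coloring c ->
  0 < #|neighbours v| -> #|neighbours v| + 2 <= k.
Proof.
move=> /vi_coloring_third_close hc /card_gt0P[w].
rewrite inE adj_sym => /incidence_of_adj[i0 i0w i0v].
pose star : {set vi_elt G} := inr @: [set i | source i == v].
pose clique := inl v |: (inr i0 |: star).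
have c_inj : {in clique &, injective c}.
  move=> x y xC yC; apply: contra_eq => xy; apply: hc => //; move: xC yC.
  have starP z : z \in star -> exists2 i, z = inr i & source i = v.
    by case/imsetP => i; rewrite inE => /eqP iv ->; exists i.
  rewrite !in_setU1 => /or3P[/eqP ->|/eqP ->|/starP[i -> iv]]
    /or3P[/eqP ->|/eqP ->|/starP[j -> jv]] /=; rewrite ?i0v ?iv ?jv;
    by [left|right|constructor 1|constructor 2|constructor 3].
have i0_star : inr i0 \notin star.
  apply/imsetP => -[i + [E]]; rewrite inE -E i0w => /eqP wv.
  by have := source_target_adj i0; rewrite i0w i0v wv adj_irrefl.
have center_star : inl v \notin inr i0 |: star.
  by rewrite in_setU1 /=; apply/imsetP => -[].
have card_clique : #|clique| = #|star| + 2.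
  by rewrite !cardsU1 center_star i0_star addnA addnC.
have star_deg : #|neighbours v| <= #|star|.
  by rewrite neighbours_target [leqRHS]card_imset ?leq_imset_card // => i j [].
have := leq_card_in c clique c_inj; rewrite card_ord card_clique; apply: leq_trans.
by rewrite leq_add2r.
Qed.

Lemma vi_coloring_lower_bound k (c : vi_elt G -> 'I_k) : 0 < max_degree G ->
  vi_coloring c -> max_degree G + 2 <= k.
Proof.
move=> D0 hc; have [v0 _|noG] := pickP (@predT G); last first.
  by move: D0; rewrite /max_degree big_pred0.
have G0 : 0 < #|G| by apply/card_gt0P; exists v0.
have [v maxv] := bigop.eq_bigmax (fun v : G => #|neighbours v|) G0.
by rewrite /max_degree maxv; apply: (vi_coloring_degree hc); rewrite -maxv.
Qed.
End Incidences.

Lemma triangle_free_girth (G : sgraph) g : is_girth G g -> 3 < g -> triangle_free G.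
Proof.
move=> [_ g_min] g3 u v w uv vw uw; have: is_cycle [:: u; v; w].
  rewrite /is_cycle /ucycleb /= uv vw adj_sym uw !inE negb_or.
  by rewrite !adj_neq.
by move/g_min; rewrite leqNgt g3.
Qed.

Theorem theorem22 (R : realType) (G : sgraph) (Delta g : nat)
  (hconn : k_connected G 2)
  (houter : outerplanar R G)
  (hDelta : max_degree G = Delta) (hDelta5 : 5 <= Delta)
  (hg : is_girth G g) (hg4 : 4 <= g) :
  is_chi_vi G 1 (Delta + 2).
Proof.
subst Delta; split; last first.
  by move=> k [c [hc _]]; apply: vi_coloring_lower_bound hc; exact: leq_trans hDelta5.
have [D [F [[fF _] cF]]] := houter.
have free := outer_face_K23_minor_free fF cF.
have tri := triangle_free_girth hg hg4.
have [[s0 cs0 _] _] := hg; have [s long_s] := exists_longest_cycle cs0.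
have all_s := longest_cycle_hamiltonian hconn free long_s.
have [/and3P[s3 cyc us] _] := long_s.
have [a [b ab]] := hamiltonian_pair_colouring cyc us all_s (ltnW s3) free tri hDelta5.
exact: vi_ks_coloring_of_pair ab.
Qed.
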